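(* Let $k$ be a field and let $G$ be a cointerval graph on $[n]$, with vertices ordered as in the context. Then the complex $F_\bullet$ (the minimal free $\mathbb{N}^n$-graded resolution of $R_G = S/I_G$), equipped with the product $\star$, is a DG-algebra (DGA) over $S=k[x_1,\dots,x_n]$. That is, the $S$-bilinear product $\star: F_i \times F_j \to F_{i+j}$ is associative, is graded commutative ($x\star y = (-1)^{|x||y|}\, y\star x$ for homogeneous $x,y$), has unit $1 \in F_0$, and satisfies the Leibniz rule $d(x\star y) = d(x)\star y + (-1)^{|x|} x\star d(y)$ for homogeneous $x,y$.
   Context: Setting. An interval graph is a graph whose vertices correspond to closed intervals $[a_i,b_i]$ ($a_i\le b_i$) of the real line, two distinct vertices being adjacent iff the corresponding intervals intersect; a cointerval graph is the complement of an interval graph. $G$ is a cointerval graph on $[n]=\{1,\dots,n\}$ with edge set $E(G)$, so for $i\neq j$ we have $\{i,j\}\in E(G)$ iff $[a_i,b_i]\cap[a_j,b_j]=\emptyset$, and the vertices are ordered so that $a_i\le a_j$ whenever $i<j$. $k$ is a field, $S=k[x_1,\dots,x_n]$, $I_G$ is the ideal generated by all $x_ix_j$ with $\{i,j\}\in E(G)$, and $R_G=S/I_G$. The complex $F_\bullet$. $B_0=\{1\}$; for $d\ge1$, $B_d$ is the set of symbols $(\sigma|\tau)$ with $\sigma,\tau\subseteq[n]$ disjoint and nonempty, $|\sigma\cup\tau|=d+1$, $\max\sigma<\min\tau$, and $\{i,\min\tau\}\in E(G)$ for all $i\in\sigma$. $F_d$ is the free $S$-module on $B_d$; elements of $\bigcup_d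 B_d$ are called basis elements, and $|x|$ denotes the homological degree of $x$ (for $x\in F_d$, $|x|=d$). The differential is $S$-linear with $d(1)=0$, $d(i|j)=x_ix_j$, and for $(\sigma|\tau)$ of degree $\ge2$ $$d(\sigma|\tau)=\sum_{i\in\sigma}(-1)^{|\tau|+|\{j\in\sigma: j>i\}|}x_i(\sigma\smallsetminus i|\tau)+\sum_{i\in\tau}(-1)^{|\{j\in\tau: j>i\}|}x_i(\sigma|\tau\smallsetminus i),$$ where non-existent basis elements are read as zero. By a known result of Chen and of Dochtermann--Engstr\''om, $F_\bullet$ is the minimal free $\mathbb{N}^n$-graded resolution of $R_G$. The homotopy $c$. $c:F_d\to F_{d+1}$ is the $k$-linear map defined on the $k$-basis of elements $x^\alpha$ (in $F_0$) and $x^\alpha(\sigma|\tau)$ as follows; $\operatorname{supp}\alpha=\{i:\alpha_i>0\}$. Order basis elements by $(\sigma_1|\tau_1)\prec(\sigma_2|\tau_2)$ if $\max\tau_1>\max\tau_2$, or $\max\tau_1=\max\tau_2$ and $\min\sigma_1<\min\sigma_2$. - $c(x^\alpha)=\frac{x^\alpha}{x_ix_j}(i|j)$ if $x^\alpha\in I_G$, where $(i|j)\in B_1$ is $\prec$-minimal such that $x_ix_j$ divides $x^\alpha$; $c(x^\alpha)=0$ if $x^\alpha\notin I_G$. For $x^\alpha(\sigma|\tau)$ put $C_1=\{i\in\operatorname{supp}\alpha: i>\max\tau\}$, $C_2=\{i\in\operatorname{supp}\alpha: i<\min\sigma,\ \{i,\min\tau\}\in E(G)\}$, $C_3=\{i\in\operatorname{supp}\alpha: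 i<\min\sigma,\ i<\max\operatorname{supp}\alpha,\ \{i,\max\operatorname{supp}\alpha\}\in E(G)\}$, and, when nonempty, $m_1=\max C_1$, $m_2=\min C_2$, $m_3=\min C_3$. - If $\tau=\{i\}$: $c(x^\alpha(\sigma|\tau))$ equals $\frac{x^\alpha}{x_{m_1}}(\sigma|\tau\cup m_1)+(-1)^{|\sigma|+1}\frac{x^\alpha x_i}{x_{m_1}x_{m_3}}(m_3\cup\sigma|m_1)$ if $C_1\ne\emptyset$, $C_3\neq\emptyset$; $\frac{x^\alpha}{x_{m_1}}(\sigma|\tau\cup m_1)$ if $C_1\ne\emptyset$, $C_3=\emptyset$; $(-1)^{|\sigma|+1}\frac{x^\alpha}{x_{m_2}}(m_2\cup\sigma|\tau)$ if $C_1=\emptyset$, $C_2\ne\emptyset$; and $0$ if $C_1=C_2=\emptyset$. - If $|\tau|\ge2$: $c(x^\alpha(\sigma|\tau))=\frac{x^\alpha}{x_{m_1}}(\sigma|\tau\cup m_1)$ if $C_1\ne\emptyset$, and $0$ otherwise. The product $\star$. $\mu:F_\bullet\otimes_SF_\bullet\to F_\bullet$ is the $S$-linear map of degree $0$ that is the canonical isomorphism $S\otimes_SS\to S$ in degree $0$ and is defined inductively on tensors $e\otimes e'$ of basis elements of total degree $m+1$ by $\mu_{m+1}(e\otimes e')=c\,\mu_m(d(e\otimes e'))$, where $d(e\otimes e')=d(e)\otimes e'+(-1)^{|e|}e\otimes d(e')$. Write $x\star y=\mu(x\otimes y)$. *)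

(* Defs.v *)
(* S = k[x_0, ..., x_(n-1)] is {mpoly k[n]}, and the vertex set
   [n] is 'I_n (indices shifted to start at 0). *)
From HB Require Import structures.
From mathcomp Require Import all_boot all_order all_algebra.
From mathcomp Require Import mpoly.
From mathcomp Require Import boolp reals.

Set Implicit Arguments.
Unset Strict Implicit.
Unset Printing Implicit Defensive.

Import Order.TTheory GRing.Theory Num.Theory.
Local Open Scope ring_scope.

Definition simple_graph (n : nat) (E : rel 'I_n) : Prop :=
  ssrbool.symmetric E /\ irreflexive E.

Definition is_cointerval_repr (R : realType) (n : nat) (E : rel 'I_n)
    (a b : 'I_n -> R) : Prop :=
  (forall i, a i <= b i) /\
  (forall i j, i != j ->
     (E i j <-> ~ exists x : R, x \in `[a i, b i] /\ x \in `[a j, b j])).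

(* Maximum and minimum of a set of vertices; None when the set is empty. *)
Definition omax (n : nat) (A : {set 'I_n}) : option 'I_n :=
  [pick i in A | [forall j in A, (j <= i)%N]].

Definition omin (n : nat) (A : {set 'I_n}) : option 'I_n :=
  [pick i in A | [forall j in A, (i <= j)%N]].

(* The pair p = (sigma, tau) is a symbol (sigma|tau); nonemptiness of sigma
   and tau is the existence of max sigma and min tau. *)
Definition is_symbol (n : nat) (E : rel 'I_n)
    (p : {set 'I_n} * {set 'I_n}) : bool :=
  match omax p.1, omin p.2 with
  | Some s, Some t =>
      [&& [disjoint p.1 & p.2], (s < t)%N & [forall i in p.1, E i t]]
  | _, _ => false
  end.

Definition symbol (n : nat) (E : rel 'I_n) : finType :=
  {p : {set 'I_n} * {set 'I_n} | is_symbol E p}.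

(* The union of all the B_d: None is the basis element 1 of F_0. *)
Definition basis (n : nat) (E : rel 'I_n) : finType := option (symbol E).

Definition bdeg (n : nat) (E : rel 'I_n) (e : basis E) : nat :=
  if e is Some p then #|(val p).1 :|: (val p).2|.-1 else 0.

(* The direct sum of the F_d, as a module over S: the regular-module tag ^o
   makes *: the action of S. *)
Definition Fcx (k : fieldType) (n : nat) (E : rel 'I_n) : lmodType {mpoly k[n]} :=
  {ffun basis E -> {mpoly k[n]}^o}.

(* F (x)_S F, the free module on the tensors of basis elements. *)
Definition FFcx (k : fieldType) (n : nat) (E : rel 'I_n) : lmodType {mpoly k[n]} :=
  {ffun basis E * basis E -> {mpoly k[n]}^o}.

Section Complex.
Variables (k : fieldType) (n : nat) (E : rel 'I_n).

Local Notation S := {mpoly k[n]}.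
Local Notation F := (Fcx k E).
Local Notation FF := (FFcx k E).

Definition coef (x : F) (e : basis E) : S := (x : {ffun basis E -> S^o}) e.

Definition coef2 (t : FF) (p : basis E * basis E) : S :=
  (t : {ffun basis E * basis E -> S^o}) p.

Definition bvec (e : basis E) : F :=
  [ffun e' => if e' == e then 1 else 0] : {ffun basis E -> S^o}.

(* x lies in F_d *)
Definition in_deg (d : nat) (x : F) : Prop :=
  forall e, bdeg e != d -> coef x e = 0.

(* (sigma|tau) as an element of F, read as zero when it does not exist. *)
Definition sym (s t : {set 'I_n}) : F :=
  if insub (s, t) is Some p then bvec (Some (p : symbol E)) else 0.

(* The squarefree exponent of the product of the x_i, i in the union of
   sigma and tau. *)
Definition smon (p : symbol E) : 'X_{1..n} :=
  [multinom ((i \in (val p).1 :|: (val p).2) : nat) | i < n].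

Definition dbas (e : basis E) : F :=
  match e with
  | None => 0
  | Some p =>
      let s := (val p).1 in
      let t := (val p).2 in
      if bdeg e == 1%N then 'X_[smon p] *: bvec None
      else
        \sum_(i in s) ((-1) ^+ (#|t| + #|[set j in s | (i < j)%N]|) * 'X_i : S)
                        *: sym (s :\ i) t
        + \sum_(i in t) ((-1) ^+ #|[set j in t | (i < j)%N]| * 'X_i : S)
                        *: sym s (t :\ i)
  end.

Definition diff (x : F) : F := \sum_(e : basis E) coef x e *: dbas e.

Definition edge_ideal (f : S) : Prop :=
  exists g : 'I_n -> 'I_n -> S,
    f = \sum_(i < n) \sum_(j < n | E i j) g i j * ('X_i * 'X_j).

Definition prec (p q : symbol E) : bool :=
  match omax (val p).2, omax (val q).2, omin (val p).1, omin (val q).1 with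
  | Some t1, Some t2, Some s1, Some s2 =>
      (t2 < t1)%N || (t1 == t2) && (s1 < s2)%N
  | _, _, _, _ => false
  end.

(* (i|j) is in B_1 and x_i x_j divides x^al *)
Definition edge_divides (al : 'X_{1..n}) (p : symbol E) : bool :=
  (bdeg (Some p) == 1%N) && (smon p <= al)%MM.

Definition prec_min_edge (al : 'X_{1..n}) : option (symbol E) :=
  [pick p | edge_divides al p && [forall q, edge_divides al q ==> ~~ prec q p]].

Definition hpty_unit (al : 'X_{1..n}) : F :=
  if `[< edge_ideal 'X_[al] >] then
    if prec_min_edge al is Some p then
      ('X_[al - smon p] : S) *: bvec (Some p)
    else 0
  else 0.

Definition msupport (al : 'X_{1..n}) : {set 'I_n} := [set i | (0 < al i)%N].

(* i < max A and {i, max A} is an edge *)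
Definition below_max_adj (A : {set 'I_n}) (i : 'I_n) : bool :=
  if omax A is Some m then (i < m)%N && E i m else false.

Definition hpty_symbol (al : 'X_{1..n}) (p : symbol E) : F :=
  let s := (val p).1 in
  let t := (val p).2 in
  let A := msupport al in
  match omin s, omin t, omax t with
  | Some mins, Some mint, Some maxt =>
      let C1 := [set i in A | (maxt < i)%N] in
      let C2 := [set i in A | (i < mins)%N && E i mint] in
      let C3 := [set i in A | (i < mins)%N && below_max_adj A i] in
      if #|t| == 1%N then (* t is the singleton of mint *)
        match omax C1, omin C2, omin C3 with
        | Some m1, _, Some m3 =>
            ('X_[al - U_(m1)] : S) *: sym s (m1 |: t)
            + ((-1) ^+ #|s|.+1 * 'X_[al + U_(mint) - (U_(m1) + U_(m3))] : S)
                *: sym (m3 |: s) [set m1]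
        | Some m1, _, None => ('X_[al - U_(m1)] : S) *: sym s (m1 |: t)
        | None, Some m2, _ =>
            ((-1) ^+ #|s|.+1 * 'X_[al - U_(m2)] : S) *: sym (m2 |: s) t
        | None, None, _ => 0
        end
      else
        match omax C1 with
        | Some m1 => ('X_[al - U_(m1)] : S) *: sym s (m1 |: t)
        | None => 0
        end
  | _, _, _ => 0
  end.

Definition hpty_bas (al : 'X_{1..n}) (e : basis E) : F :=
  if e is Some p then hpty_symbol al p else hpty_unit al.

(* The k-linear extension of hpty_bas: a scalar z of k acts as z%:MP. *)
Definition hpty (x : F) : F :=
  \sum_(e : basis E) \sum_(al <- msupp (coef x e))
     ((coef x e)@_al)%:MP *: hpty_bas al e.

Definition tensor (x y : F) : FF :=
  [ffun p => coef x p.1 * coef y p.2] : {ffun basis E * basis E -> S^o}.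

Definition bdeg2 (p : basis E * basis E) : nat := (bdeg p.1 + bdeg p.2)%N.

(* d(e (x) e') = d(e) (x) e' + (-1)^|e| e (x) d(e') *)
Definition dbas2 (p : basis E * basis E) : FF :=
  tensor (dbas p.1) (bvec p.2)
  + ((-1) ^+ bdeg p.1 : S) *: tensor (bvec p.1) (dbas p.2).

(* mubas m p is meaningful for bdeg2 p = m: it is then mu_m on the tensor of
   basis elements p. For m = 0 the only such tensor is 1 (x) 1. *)
Fixpoint mubas (m : nat) (p : basis E * basis E) : F :=
  match m with
  | 0 => bvec None
  | m'.+1 =>
      hpty (\sum_(q : basis E * basis E) coef2 (dbas2 p) q *: mubas m' q)
  end.

Definition mu (t : FF) : F :=
  \sum_(p : basis E * basis E) coef2 t p *: mubas (bdeg2 p) p.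

Definition star (x y : F) : F := mu (tensor x y).

End Complex.

(* Differential graded algebra over S, commutative in the graded sense, on a
   module A whose homogeneous component of degree i is deg i. *)
Record is_cdga (S : comNzRingType) (A : lmodType S) (deg : nat -> A -> Prop)
    (d : A -> A) (mul : A -> A -> A) (one : A) : Prop := IsCDGA {
  cdga_d_linear : linear d;
  cdga_d_deg0 : forall x, deg 0%N x -> d x = 0;
  cdga_d_deg : forall i x, deg i.+1 x -> deg i (d x);
  cdga_dd : forall x, d (d x) = 0;
  cdga_mul_linear_l : forall y, linear (fun x => mul x y);
  cdga_mul_linear_r : forall x, linear (mul x);
  cdga_mul_deg : forall i j x y, deg i x -> deg j y -> deg (i + j)%N (mul x y);
  cdga_mulA : forall x y z, mul x (mul y z) = mul (mul x y) z;
  cdga_mulC : forall i j x y, deg i x -> deg j y ->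
    mul x y = ((-1) ^+ (i * j) : S) *: mul y x;
  cdga_one_deg : deg 0%N one;
  cdga_mul1x : forall x, mul one x = x;
  cdga_mulx1 : forall x, mul x one = x;
  cdga_leibniz : forall i j x y, deg i x -> deg j y ->
    d (mul x y) = mul (d x) y + ((-1) ^+ i : S) *: mul x (d y)
}.

(* Main.v *)
Require Import Defs.
From HB Require Import structures.
From mathcomp Require Import all_boot all_order all_algebra.
From mathcomp Require Import mpoly ssrcomplements.
From mathcomp Require Import boolp reals.
From mathcomp Require Import zify ring.

(** Order the vertices by the left ends of their intervals.  For [i < j] the
    intervals are disjoint iff [b_i < a_j], so the later neighbours of a vertex
    are closed upwards ([cointerval_up_closed]).  So [(s|t)] is a symbol iff
    both halves are nonempty and every element of [s] lies below, and is joined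
    to, every element of [t] ([symbolP]).  In this description the differential
    removes vertices one at a time, with the sign given by the number of larger
    vertices.

    The homotopy [c] is the sum of two simpler maps.  [extend_tau] adjoins to
    [tau] the largest vertex of the coefficient; it contracts the larger
    complex in which [tau] may be empty.  [extend_sigma] adjoins to [sigma] the
    smallest vertex that can stand below it, and contracts what
    [extend_tau] leaves over, namely the terms in which [tau] has become empty.
    Together they give [d c + c d = 1] in positive degrees
    ([homotopy_gsym], [homotopy]).

    Let [star] be the product, so [e star e' = c (d (e tensor e'))] on basis
    elements.  Unit, graded commutativity and the Leibniz rule then follow by
    induction on the total degree.  For associativity the associator of three
    basis elements is a cycle by the Leibniz rule and induction, so it vanishes
    once [c] kills it ([cycle_eq0]); the point is that [c] kills both
    [(e1 star e2) star e3] and [e1 star (e2 star e3)] ([c_star_star]).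

    This rests on the shape of the terms of a product. A term [x^al (s|t)]
    in the image of [c] is reduced: no vertex of [al] lies above [max t],
    and, if [t] is a single vertex, no vertex of [al] lies below [s] and is
    joined to [t]. Reduced elements of positive degree are killed by [c]
    ([c_of_reduced]). In a product of two basis elements, if [t] is a single
    vertex, then the smallest vertex of the whole multidegree lies in [s]
    ([anchored_of_reduced], [star_anchored]). If the first factor has at
    least two vertices in its [tau], then so do all terms of the product
    ([star_tau_ge2]). Hence a term of [(e1 star e2) star e3] with a single
    vertex in [tau] comes from a term of [e1 star e2] with a single vertex
    in [tau], and both are anchored, so that no coefficient vertex lies
    below its [sigma]: the term is again reduced. *)

Set Implicit Arguments.
Unset Strict Implicit.
Unset Printing Implicit Defensive.

Import Order.TTheory GRing.Theory Num.Theory.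
Local Open Scope ring_scope.

(** * Symbols as pairs of vertex sets *)
Section Symbols.
Variables (n : nat) (E : rel 'I_n).

Lemma setD1_notin (A : {set 'I_n}) x : x \notin A -> A :\ x = A.
Proof. by move=> xA; apply/setDidPl; rewrite disjoint_sym disjoints1. Qed.

Lemma omaxP (A : {set 'I_n}) :
  match omax A with
  | Some m => m \in A /\ forall j, j \in A -> (j <= m)%N
  | None => A = set0
  end.
Proof.
rewrite /omax; case: pickP => [m /andP[mA /forall_inP mM] //|noM].
apply/eqP/set0Pn => -[x xA].
case: (arg_maxnP (fun i : 'I_n => nat_of_ord i) xA) => m mA mM.
by have /negP[] := noM m; apply/andP; split=> //; apply/forall_inP.
Qed.

Lemma ominP (A : {set 'I_n}) :
  match omin A with
  | Some m => m \in A /\ forall j, j \in A -> (m <= j)%N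
  | None => A = set0
  end.
Proof.
rewrite /omin; case: pickP => [m /andP[mA /forall_inP mM] //|noM].
apply/eqP/set0Pn => -[x xA].
case: (arg_minnP (fun i : 'I_n => nat_of_ord i) xA) => m mA mM.
by have /negP[] := noM m; apply/andP; split=> //; apply/forall_inP.
Qed.

Lemma omax_eq (A : {set 'I_n}) m :
  m \in A -> (forall j, j \in A -> (j <= m)%N) -> omax A = Some m.
Proof.
move=> mA mM; have := omaxP A; case: (omax A) => [m' [m'A m'M]|A0].
  by congr Some; apply/val_inj/eqP; rewrite eqn_leq mM ?m'M.
by rewrite A0 inE in mA.
Qed.

Lemma omin_eq (A : {set 'I_n}) m :
  m \in A -> (forall j, j \in A -> (m <= j)%N) -> omin A = Some m.
Proof.
move=> mA mM; have := ominP A; case: (omin A) => [m' [m'A m'M]|A0].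
  by congr Some; apply/val_inj/eqP; rewrite eqn_leq mM ?m'M.
by rewrite A0 inE in mA.
Qed.

Definition sig (e : Defs.basis E) : {set 'I_n} :=
  if e is Some p then (val p).1 else set0.

Definition tau (e : Defs.basis E) : {set 'I_n} :=
  if e is Some p then (val p).2 else set0.

(** The exponent of the degree of [(s|t)] in the [N^n]-grading. *)
Definition multideg (s t : {set 'I_n}) : 'X_{1..n} :=
  [multinom ((i \in s :|: t) : nat) | i < n].

(** The sign with which a vertex of [(s|t)] is removed depends only on the
    number of larger vertices of [s :|: t], because [t] lies above [s]. *)
Definition nabove (i : 'I_n) (U : {set 'I_n}) : nat :=
  #|[set j in U | (i < j)%N]|.

Lemma nabove_top (i m : 'I_n) (U : {set 'I_n}) :
  (forall j, j \in U -> (j < m)%N) -> (i < m)%N ->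
  nabove i (m |: U) = (nabove i U).+1.
Proof.
move=> Um im; rewrite /nabove.
have -> : [set j in m |: U | (i < j)%N] = m |: [set j in U | (i < j)%N].
  by apply/setP => j; rewrite !inE; case: eqP => // ->; rewrite im.
rewrite cardsU1 !inE; case mU: (m \in U) => //.
by have := Um _ mU; rewrite ltnn.
Qed.

Lemma nabove_max (m : 'I_n) (U : {set 'I_n}) :
  (forall j, j \in U -> (j <= m)%N) -> nabove m U = 0%N.
Proof.
move=> Um; apply: eq_card0 => j; rewrite !inE.
by case jU: (j \in U) => //=; rewrite ltnNge Um.
Qed.

Lemma nabove_bot (i r : 'I_n) (U : {set 'I_n}) :
  (r < i)%N -> nabove i (r |: U) = nabove i U.
Proof.
move=> ri; congr #|pred_of_set _|; apply/setP => j; rewrite !inE.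
by case: eqP => // ->; rewrite ltnNge (ltnW ri) /= andbF.
Qed.

Lemma nabove_min (r : 'I_n) (U : {set 'I_n}) :
  (forall j, j \in U -> (r < j)%N) -> nabove r (r |: U) = #|U|.
Proof.
move=> Ur; congr #|pred_of_set _|; apply/setP => j; rewrite !inE.
case: eqP => [->|_] /=; last by case jU: (j \in U) => //; rewrite Ur.
by rewrite ltnn; case rU: (r \in U) => //; have := Ur _ rU; rewrite ltnn.
Qed.

Lemma nabove_rem (i j : 'I_n) (U : {set 'I_n}) :
  j \in U -> nabove i U = ((i < j)%N + nabove i (U :\ j))%N.
Proof.
move=> jU; rewrite /nabove.
rewrite (cardsD1 j [set x in U | (i < x)%N]) inE jU /=; congr addn.
by apply: eq_card => x; rewrite !inE andbA.
Qed.

(** [b] is the next vertex of [U] after [a]. *)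
Lemma nabove_next (a b : 'I_n) (U : {set 'I_n}) :
  b \in U -> (a < b)%N ->
  (forall j, j \in U -> (a < j)%N -> j != b -> (b < j)%N) ->
  nabove a U = (nabove b U).+1.
Proof.
move=> bU ab hU; rewrite (nabove_rem _ bU) ab add1n (nabove_rem b bU) ltnn add0n.
congr S; congr #|pred_of_set _|; apply/setP => j; rewrite !inE.
case jb: (j == b) => //=; case jU: (j \in U) => //=.
apply/idP/idP => [aj|]; [by rewrite hU ?jb | exact: ltn_trans].
Qed.

Hypothesis E_up : forall i j j' : 'I_n, (i < j)%N -> (j <= j')%N -> E i j -> E i j'.

(** The later neighbours of a vertex are closed upwards, so being joined to
    [min tau] is the same as being joined to all of [tau]. *)
Lemma symbolP (s t : {set 'I_n}) :
  reflect [/\ s != set0, t != set0 &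
              forall i j, i \in s -> j \in t -> (i < j)%N /\ E i j]
          (is_symbol E (s, t)).
Proof.
rewrite /is_symbol /=; apply: (iffP idP) => [|[s0 t0 st]].
  have := omaxP s; case: (omax s) => // M [Ms MM].
  have := ominP t; case: (omin t) => // m [mt mm].
  case/and3P => _ Mm /forall_inP sE; split=> [||i j si tj].
  - by apply/set0Pn; exists M.
  - by apply/set0Pn; exists m.
  - have im: (i < m)%N by apply: leq_ltn_trans Mm; exact: MM.
    split; first exact: leq_trans (mm _ tj).
    by apply: E_up im (mm _ tj) _; exact: sE.
have := omaxP s; case: (omax s) => [M [Ms MM]|se]; last by rewrite se eqxx in s0.
have := ominP t; case: (omin t) => [m [mt mm]|te]; last by rewrite te eqxx in t0.
apply/and3P; split; last by apply/forall_inP => i si; case: (st _ _ si mt).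
  rewrite disjoint_subset; apply/subsetP => i si; rewrite inE.
  by apply/negP => ti; have [] := st _ _ si ti; rewrite ltnn.
by case: (st _ _ Ms mt).
Qed.

Lemma symbol_disjoint (s t : {set 'I_n}) :
  is_symbol E (s, t) -> s :&: t = set0.
Proof.
move=> /symbolP[_ _ st]; apply/setP => i; rewrite !inE.
by apply/negP => /andP[si ti]; have [] := st _ _ si ti; rewrite ltnn.
Qed.

Lemma card_symbol (s t : {set 'I_n}) :
  is_symbol E (s, t) -> #|s :|: t| = (#|s| + #|t|)%N.
Proof. by move=> st; rewrite cardsU symbol_disjoint // cards0 subn0. Qed.

Lemma bdegE e : bdeg e = (#|sig e| + #|tau e|).-1.
Proof.
case: e => [[[s t] st]|]; last by rewrite /= cards0.
by rewrite /= card_symbol.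
Qed.

Lemma symbol_bdeg_gt0 s t : is_symbol E (s, t) -> (0 < (#|s| + #|t|).-1)%N.
Proof.
case/symbolP; rewrite -!card_gt0 => s0 t0 _.
by case: #|s| s0 => // a _; case: #|t| t0 => // b _; rewrite addnS.
Qed.

Lemma symbol_face (s t s' t' : {set 'I_n}) :
  is_symbol E (s, t) -> s' \subset s -> t' \subset t -> s' != set0 -> t' != set0 ->
  is_symbol E (s', t').
Proof.
move=> /symbolP[_ _ st] /subsetP s's /subsetP t't s0 t0; apply/symbolP.
by split=> // i j /s's si /t't tj; exact: st.
Qed.

Lemma symbol_edge (s t : {set 'I_n}) (i j : 'I_n) :
  is_symbol E (s, t) -> i \in s -> j \in t -> is_symbol E ([set i], [set j]).
Proof.
move=> st si tj; apply: symbol_face st _ _ _ _; rewrite ?sub1set //.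
  by apply/set0Pn; exists i; rewrite inE.
by apply/set0Pn; exists j; rewrite inE.
Qed.

Lemma symbol_adjoin_max (s t : {set 'I_n}) (m : 'I_n) :
  is_symbol E (s, t) -> (forall j, j \in t -> (j < m)%N) ->
  is_symbol E (s, m |: t).
Proof.
move=> /symbolP[s0 /set0Pn[j tj] st] tm; apply/symbolP; split=> //.
  by apply/set0Pn; exists m; rewrite !inE eqxx.
move=> x y sx; rewrite !inE => /orP[/eqP->|]; last exact: st.
have [xj Exj] := st _ _ sx tj; split; first exact: ltn_trans (tm _ tj).
exact: E_up xj (ltnW (tm _ tj)) Exj.
Qed.

Lemma symbol_lt_union (s t : {set 'I_n}) (m : 'I_n) :
  is_symbol E (s, t) -> (forall j, j \in t -> (j < m)%N) ->
  forall j, j \in s :|: t -> (j < m)%N.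
Proof.
move=> /symbolP[_ /set0Pn[u tu] st] tm j; rewrite inE => /orP[sj|/tm//].
exact: ltn_trans (st _ _ sj tu).1 (tm _ tu).
Qed.

End Symbols.

Arguments setD1_notin [n] A [x] _.

(** * The complex over a ring with monomials *)

(** The laws on which the argument runs: [iota] includes the scalars and [X] the
    monomials in the ring [S], the generators span [F] over the monomials, and
    the differential, the homotopy and the product are determined by their
    values on generators. *)
Section Calculus.
Variables (n : nat) (E : rel 'I_n).
Hypothesis E_up : forall i j j' : 'I_n, (i < j)%N -> (j <= j')%N -> E i j -> E i j'.

Variables (K : pzRingType) (S : comNzRingType) (F : lmodType S).
Variables (iota : {rmorphism K -> S}) (X : 'X_{1..n} -> S).
Hypotheses (X0 : X 0%MM = 1) (XD : forall al be, X (al + be)%MM = X al * X be).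

Variable gen : Defs.basis E -> F.

Definition gsym (s t : {set 'I_n}) : F :=
  if insub (s, t) is Some p then gen (Some (p : symbol E)) else 0.

Variables (d : {linear F -> F}) (c : {additive F -> F}).

Definition face_coef (i : 'I_n) (U : {set 'I_n}) : S := (-1) ^+ nabove i U * X U_(i).

Hypothesis d_one : d (gen None) = 0.
Hypothesis d_edge : forall i j, is_symbol E ([set i], [set j]) ->
  d (gsym [set i] [set j]) = (X U_(i) * X U_(j)) *: gen None.
Hypothesis d_sym : forall s t, is_symbol E (s, t) -> (2 < #|s| + #|t|)%N ->
  d (gsym s t) = \sum_(i in s :|: t) face_coef i (s :|: t) *: gsym (s :\ i) (t :\ i).

Lemma gsym0 s t : ~~ is_symbol E (s, t) -> gsym s t = 0.
Proof. by move=> st; rewrite /gsym insubN. Qed.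

Lemma gsym_gen (p : symbol E) : gsym (val p).1 (val p).2 = gen (Some p).
Proof.
rewrite /gsym; have -> : ((val p).1, (val p).2) = val p by case: (val p).
by rewrite valK.
Qed.

Lemma gsym_s0 t : gsym set0 t = 0.
Proof. by apply/gsym0/negP => /(symbolP E_up)[]; rewrite eqxx. Qed.

Lemma gsym_t0 s : gsym s set0 = 0.
Proof. by apply/gsym0/negP => /(symbolP E_up)[]; rewrite eqxx. Qed.

Lemma genP e : e = None \/
  exists s t, [/\ is_symbol E (s, t), sig e = s, tau e = t & gen e = gsym s t].
Proof.
case: e => [p|]; [right | by left].
exists (val p).1, (val p).2; split=> //; last by rewrite gsym_gen.
by case: p => -[].
Qed.

Lemma gsym_genE s t : is_symbol E (s, t) ->
  exists2 e, sig e = s /\ tau e = t & gsym s t = gen e.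
Proof.
move=> st; exists (Some (Sub (s, t) st : symbol E)) => //.
exact: (gsym_gen (Sub (s, t) st : symbol E)).
Qed.

(** * The differential squares to zero *)

(** Each term cancels its mirror image.  Showing that the sum is its own
    opposite would not be enough in characteristic two. *)
Lemma antisym_sum0 (A : {set 'I_n}) (G : 'I_n -> 'I_n -> F) :
  (forall i j, i \in A -> j \in A -> (i < j)%N -> G i j = - G j i) ->
  \sum_(i in A) \sum_(j in A :\ i) G i j = 0.
Proof.
move=> hG.
have split_row i : i \in A -> \sum_(j in A :\ i) G i j =
    \sum_(j in A | (i < j)%N) G i j + \sum_(j in A | (j < i)%N) G i j.
  move=> iA; rewrite (bigID (fun j : 'I_n => (i < j)%N)) /=; congr (_ + _).
    apply: eq_bigl => j; rewrite !inE.
    by case: (eqVneq j i) => [->|_]; rewrite ?ltnn ?andbF.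
  apply: eq_bigl => j; rewrite !inE -leqNgt -val_eqE /= ltn_neqAle.
  by case: eqP => //=; rewrite ?andbF.
rewrite (eq_bigr _ split_row) big_split /= (exchange_big_dep (mem A)) /=; last first.
  by move=> i j _ /andP[].
rewrite -big_split /=; apply: big1 => i iA.
have -> : \sum_(j in A | (i \in A) && (j < i)%N) G j i =
    - \sum_(j in A | (j < i)%N) G i j.
  rewrite -sumrN iA; apply: eq_bigr => j /andP[jA ji]; exact: hG.
by rewrite addNr.
Qed.

(** Two vertices that no third vertex of [U] separates are removed with
    opposite signs. *)
Lemma sgn_pair (a b : 'I_n) (U : {set 'I_n}) :
  a \in U -> b \in U -> a != b ->
  (forall j, j \in U -> j != a -> j != b -> (j < a)%N = (j < b)%N) ->
  (-1) ^+ nabove a U + (-1) ^+ nabove b U = 0 :> S.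
Proof.
wlog ab : a b / (a < b)%N => [hw aU bU neq_ab hU|aU bU _ hU].
  have /orP[ab|ba] : (a < b)%N || (b < a)%N by rewrite -neq_ltn.
    exact: hw.
  by rewrite addrC; apply: hw => // [|j jU jb ja]; rewrite 1?eq_sym // hU.
rewrite (nabove_next bU ab) ?exprS ?mulN1r ?addNr // => j jU aj jb.
have ja : j != a by rewrite -val_eqE /= gtn_eqF.
by rewrite ltn_neqAle eq_sym jb leqNgt -hU // -leqNgt ltnW.
Qed.

Definition boundary (s t : {set 'I_n}) : F :=
  \sum_(i in s :|: t) face_coef i (s :|: t) *: gsym (s :\ i) (t :\ i).

Lemma setUD1 (s t : {set 'I_n}) i : s :\ i :|: t :\ i = (s :|: t) :\ i.
Proof. by rewrite setDUl. Qed.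

(** A face that is not a symbol has an empty half, and so have all its faces:
    the formula for [d] holds for it too. *)
Lemma d_face s t i : is_symbol E (s, t) -> i \in s :|: t ->
  (3 < #|s| + #|t|)%N -> d (gsym (s :\ i) (t :\ i)) = boundary (s :\ i) (t :\ i).
Proof.
move=> st iU sz.
have [ist|nst] := boolP (is_symbol E (s :\ i, t :\ i)).
  apply: d_sym => //; rewrite -(card_symbol E_up ist) setUD1.
  by move: sz; rewrite -(card_symbol E_up st) (cardsD1 i (s :|: t)) iU.
rewrite gsym0 // linear0 /boundary big1 // => j _.
rewrite gsym0 ?scaler0 //; apply: contra nst => /(symbolP E_up)[s0 t0 _].
apply: (symbol_face E_up st); rewrite ?subsetDl //.
  by apply: contraNneq s0 => ->; rewrite set0D.
by apply: contraNneq t0 => ->; rewrite set0D.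
Qed.

(** Two vertices can be removed in either order, with opposite signs, and
    whether the result is a symbol depends only on the order-independent final
    halves.  Three vertices are a case apart, since the boundary of an edge is
    a monomial and not a sum of faces. *)
Lemma dd_gsym s t : is_symbol E (s, t) -> d (d (gsym s t)) = 0.
Proof.
move=> st; have := symbol_bdeg_gt0 E_up st.
have [sz|sz _] := leqP (#|s| + #|t|) 2.
  case/(symbolP E_up): (st); rewrite -!card_gt0 => s0 t0 _ _.
  have /cards1P[i si] : #|s| == 1%N by move: sz s0 t0; clear; lia.
  have /cards1P[j tj] : #|t| == 1%N by move: sz s0 t0; clear; lia.
  by rewrite si tj in st *; rewrite d_edge // linearZ /= d_one scaler0.
rewrite d_sym // linear_sum /=.
have [sz3|sz3] := leqP (#|s| + #|t|) 3; last first.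
  under eq_bigr => i iU do rewrite linearZ /= d_face // /boundary scaler_sumr setUD1.
  apply: antisym_sum0 => i j iU jU ij.
  rewrite !scalerA -scaleNr !setDDl ![[set j] :|: _]setUC; congr (_ *: _).
  rewrite /face_coef (nabove_rem i jU) (nabove_rem j iU) ij ltnNge (ltnW ij) /=.
  rewrite add1n add0n exprS; ring.
have sum3 (a b x : 'I_n) : s :|: t = x |: [set a; b] ->
    x != a -> x != b -> a != b -> gsym (s :\ x) (t :\ x) = 0 ->
    d (gsym (s :\ a) (t :\ a)) = (X U_(b) * X U_(x)) *: gen None ->
    d (gsym (s :\ b) (t :\ b)) = (X U_(a) * X U_(x)) *: gen None ->
    (x < a)%N = (x < b)%N ->
    \sum_(i in s :|: t) d (face_coef i (s :|: t) *: gsym (s :\ i) (t :\ i)) = 0.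
  move=> Uabx xa xb ab fx fa fb xab; rewrite {1}Uabx.
  rewrite big_setU1 ?inE ?negb_or ?xa //= big_setU1 ?inE //= big_set1.
  rewrite !linearZ /= fx fa fb linear0 scaler0 add0r !scalerA -scalerDl.
  have /eqP : (-1) ^+ nabove a (s :|: t) + (-1) ^+ nabove b (s :|: t) = 0 :> S.
    apply: sgn_pair => //; rewrite ?Uabx ?inE ?eqxx ?orbT // => j.
    by rewrite !inE => /orP[/eqP->|/orP[]/eqP->]; rewrite ?eqxx.
  rewrite addr_eq0 /face_coef => /eqP ->.
  suff -> : - (-1) ^+ nabove b (s :|: t) * X U_(a) * (X U_(b) * X U_(x)) +
     (-1) ^+ nabove b (s :|: t) * X U_(b) * (X U_(a) * X U_(x)) = 0 by rewrite scale0r.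
  ring.
have setD2l (a b : 'I_n) : a != b -> [set a; b] :\ a = [set b].
  by move=> ab; rewrite setU1K ?inE.
case/(symbolP E_up): (st); rewrite -!card_gt0 => s0 t0 lt_st.
have [s2|s2] : #|s| == 2%N /\ #|t| == 1%N \/ #|s| == 1%N /\ #|t| == 2%N.
  by move: sz sz3 s0 t0; clear; lia.
- have /cards2P[a [b [ab es]]] := s2.1; have /cards1P[x et] := s2.2.
  have [ax bx] : (a < x)%N /\ (b < x)%N.
    by split; apply: (lt_st _ _ _ _).1; rewrite ?es ?et !inE eqxx ?orbT.
  have [xa xb] : x != a /\ x != b by rewrite -!val_eqE /= !gtn_eqF.
  apply: (sum3 a b x) => //; first by rewrite es et setUC.
  + by rewrite et setDv gsym_t0.
  + have st1 : is_symbol E ([set b], [set x]).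
      by apply: (symbol_edge E_up st); rewrite ?es ?et !inE eqxx ?orbT.
    by rewrite es et setD2l // setD1_notin ?inE 1?eq_sym // d_edge.
  + have st1 : is_symbol E ([set a], [set x]).
      by apply: (symbol_edge E_up st); rewrite ?es ?et !inE eqxx ?orbT.
    by rewrite es et setUC setD2l 1?eq_sym // setD1_notin ?inE 1?eq_sym // d_edge.
  + by rewrite ltnNge (ltnW ax) ltnNge (ltnW bx).
- have /cards2P[a [b [ab et]]] := s2.2; have /cards1P[x es] := s2.1.
  have [xa xb] : (x < a)%N /\ (x < b)%N.
    by split; apply: (lt_st _ _ _ _).1; rewrite ?es ?et !inE eqxx ?orbT.
  have [nxa nxb] : x != a /\ x != b by rewrite -!val_eqE /= !ltn_eqF.
  apply: (sum3 a b x) => //; first by rewrite es et.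
  + by rewrite es setDv gsym_s0.
  + have st1 : is_symbol E ([set x], [set b]).
      by apply: (symbol_edge E_up st); rewrite ?es ?et !inE eqxx ?orbT.
    by rewrite es et setD2l // setD1_notin ?inE 1?eq_sym // d_edge // mulrC.
  + have st1 : is_symbol E ([set x], [set a]).
      by apply: (symbol_edge E_up st); rewrite ?es ?et !inE eqxx ?orbT.
    by rewrite es et setUC setD2l 1?eq_sym // setD1_notin ?inE 1?eq_sym // d_edge // mulrC.
  + by rewrite xa xb.
Qed.

(** * The homotopy contracts *)

(** [t] may be empty here: the value at [t = set0] is the correction term that
    [extend_sigma] accounts for. *)
Definition extend_tau (al : 'X_{1..n}) (s t : {set 'I_n}) : F :=
  if omax (msupport al) is Some m then
    if [forall j in t, (j < m)%N] then X (al - U_(m))%MM *: gsym s (m |: t) else 0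
  else 0.

Definition extend_sigma_set (M : 'I_n) (al : 'X_{1..n}) (s : {set 'I_n}) : {set 'I_n} :=
  [set j in msupport al | [&& (j < M)%N, E j M & [forall i in s, (j < i)%N]]].

(** With [al] the exponent of [x^be x_u], this is the part of [c (x^be (s|u))]
    that enlarges [s].  If [u] is the largest vertex then [M = u] and [r] is
    [m_2]; otherwise [M] is [m_1] and [r] is [m_3].  For [s = set0] it is, up
    to sign, the value of [c] at the monomial [x^al]. *)
Definition extend_sigma (al : 'X_{1..n}) (s : {set 'I_n}) : F :=
  if omax (msupport al) is Some M then
    if omin (extend_sigma_set M al s) is Some r then
      ((-1) ^+ #|s|.+1 * X (al - (U_(M) + U_(r)))%MM) *: gsym (r |: s) [set M]
    else 0
  else 0.

Lemma addmAC (al be ga : 'X_{1..n}) : (al + be + ga = al + ga + be)%MM.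
Proof. by rewrite -addmA [(be + _)%MM]addmC addmA. Qed.

Lemma mem_msupport (al : 'X_{1..n}) i : (i \in msupport al) = (0 < al i)%N.
Proof. by rewrite inE. Qed.

Lemma msupportD (al be : 'X_{1..n}) i :
  (i \in msupport (al + be)%MM) = (i \in msupport al) || (i \in msupport be).
Proof. by rewrite !inE mnmDE addn_gt0. Qed.

Lemma msupportU (i j : 'I_n) : (j \in msupport U_(i)%MM) = (j == i).
Proof. by rewrite inE mnm1E lt0b eq_sym. Qed.

Lemma mnm_split (al : 'X_{1..n}) i : i \in msupport al ->
  exists be, al = (be + U_(i))%MM.
Proof.
rewrite inE => ai; exists (al - U_(i))%MM; rewrite submK //.
by apply/mnm_lepP => j; rewrite mnm1E; case: eqP => // <-.
Qed.

Lemma extend_tauE (be : 'X_{1..n}) (m : 'I_n) (s t : {set 'I_n}) :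
  (forall i, i \in msupport be -> (i <= m)%N) -> (forall j, j \in t -> (j < m)%N) ->
  extend_tau (be + U_(m)) s t = X be *: gsym s (m |: t).
Proof.
move=> bm tm; rewrite /extend_tau (@omax_eq _ _ m); first last.
- by move=> j; rewrite msupportD msupportU => /orP[/bm|/eqP->].
- by rewrite msupportD msupportU eqxx orbT.
have -> : [forall j in t, (j < m)%N] by apply/forall_inP.
by rewrite addmK.
Qed.

Lemma extend_tau0 (al : 'X_{1..n}) (s t : {set 'I_n}) :
  (forall i, i \in msupport al -> exists2 j, j \in t & (i <= j)%N) ->
  extend_tau al s t = 0.
Proof.
move=> at_; rewrite /extend_tau; have := omaxP (msupport al).
case: omax => // m [ma _]; case: forall_inP => // tm.
by have [j /tm jm] := at_ _ ma; rewrite leqNgt jm.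
Qed.

Lemma extend_tau_sigma0 al t : extend_tau al set0 t = 0.
Proof.
rewrite /extend_tau; case: omax => // m; case: ifP => // _.
by rewrite gsym_s0 scaler0.
Qed.

Lemma extend_sigmaE (be : 'X_{1..n}) (M r : 'I_n) (s : {set 'I_n}) :
  (forall i, i \in msupport be -> (i <= M)%N) -> (r < M)%N -> E r M ->
  (forall i, i \in s -> (r < i)%N) ->
  (forall j, j \in msupport be -> (j < M)%N -> E j M ->
     (forall i, i \in s -> (j < i)%N) -> (r <= j)%N) ->
  extend_sigma (be + U_(r) + U_(M)) s = ((-1) ^+ #|s|.+1 * X be) *: gsym (r |: s) [set M].
Proof.
move=> bM rM ErM rs rmin; rewrite /extend_sigma (@omax_eq _ _ M); first last.
- move=> j; rewrite !msupportD !msupportU => /orP[/orP[/bM|/eqP->]|/eqP->] //.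
  exact: ltnW.
- by rewrite !msupportD !msupportU eqxx orbT.
rewrite (@omin_eq _ _ r); first last.
- move=> j; rewrite inE !msupportD !msupportU => /andP[ja /and3P[jM EjM /forall_inP js]].
  case/orP: ja => [/orP[jb|/eqP->]|/eqP jM'] //; first exact: rmin.
  by rewrite jM' ltnn in jM.
- rewrite inE !msupportD !msupportU eqxx orbT rM ErM /=.
  exact/forall_inP.
by rewrite -addmA [(U_(r) + _)%MM]addmC addmK.
Qed.

Lemma extend_sigma0 (M : 'I_n) (al : 'X_{1..n}) (s : {set 'I_n}) :
  M \in msupport al -> (forall i, i \in msupport al -> (i <= M)%N) ->
  (forall j, j \in msupport al -> (j < M)%N -> E j M ->
     exists2 i, i \in s & (i <= j)%N) ->
  extend_sigma al s = 0.
Proof.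
move=> Ma aM no; rewrite /extend_sigma (omax_eq Ma aM).
have := ominP (extend_sigma_set M al s); case: omin => // r [+ _].
rewrite inE => /andP[ra /and3P[rM ErM /forall_inP rs]].
by have [i /rs ri] := no _ ra rM ErM; rewrite leqNgt ri.
Qed.

Lemma scale_face_sum (al : 'X_{1..n}) (U : {set 'I_n}) (G : 'I_n -> F) :
  X al *: (\sum_(i in U) face_coef i U *: G i) =
  \sum_(i in U) (-1) ^+ nabove i U *: (X (al + U_(i))%MM *: G i).
Proof.
rewrite scaler_sumr; apply: eq_bigr => i _; rewrite !scalerA /face_coef XD.
by congr (_ *: _); ring.
Qed.

(** Removing the vertex just adjoined gives back [x^al (s|t)].  Removing any
    other vertex commutes with adjoining the maximum, up to a sign, since all
    vertices of the symbol lie below it.  If the maximum of [al] does not lie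
    above [t], then only the face without [max t] contributes: the vertex that
    it lost is put back. *)
Lemma extend_tau_homotopy (al : 'X_{1..n}) (s t : {set 'I_n}) : is_symbol E (s, t) ->
  d (extend_tau al s t) + \sum_(i in s :|: t)
     (-1) ^+ nabove i (s :|: t) *: extend_tau (al + U_(i)) (s :\ i) (t :\ i) =
  X al *: gsym s t.
Proof.
move=> st; have [s0 t0 lt_st] := symbolP E_up _ _ st.
have [[m [be [-> bm] tm]]|noM] : (exists m, exists2 be,
     al = (be + U_(m))%MM /\ (forall i, i \in msupport be -> (i <= m)%N) &
     forall j, j \in t -> (j < m)%N) \/
   (forall i, i \in msupport al -> exists2 j, j \in t & (i <= j)%N).
- have := omaxP (msupport al); case: omax => [m [ma mM]|a0]; last first.
    by right=> i; rewrite a0 inE.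
  case: (boolP [exists j in t, (m <= j)%N]) => [/exists_inP[j tj mj]|].
    by right=> i /mM im; exists j; rewrite ?(leq_trans im).
  rewrite negb_exists_in => /forall_inP tm; left.
  have [be ab] := mnm_split ma; exists m, be.
    by split=> // j jb; apply: mM; rewrite ab msupportD jb.
  by move=> j /tm; rewrite -ltnNge.
- have Um := symbol_lt_union E_up st tm.
  have mU : m \notin s :|: t by apply/negP => /Um; rewrite ltnn.
  have mst := symbol_adjoin_max E_up st tm.
  rewrite extend_tauE // linearZ /= d_sym //; last first.
    rewrite cardsU1; have -> : m \notin t by apply: contra mU; rewrite inE orbC => ->.
    move: s0 t0; rewrite -!card_gt0; clear; lia.
  rewrite scale_face_sum setUCA big_setU1 //= nabove_max ?expr0 ?scale1r; last first.
    by move=> j; rewrite !inE => /orP[/eqP->|jU] //; apply/ltnW/Um; rewrite inE.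
  have [ms mt] : m \notin s /\ m \notin t by move: mU; rewrite inE negb_or => /andP.
  rewrite setD1_notin // setU1K // -addrA -big_split /= big1 ?addr0 // => i iU.
  have im := Um _ iU.
  rewrite nabove_top // exprS mulN1r scaleNr.
  have -> : (m |: t) :\ i = m |: (t :\ i).
    apply/setP => j; rewrite !inE; case: (eqVneq j m) => //= ->.
    by rewrite -val_eqE /= gtn_eqF.
  rewrite addmAC extend_tauE ?addNr //.
    by move=> j; rewrite msupportD msupportU => /orP[/bm|/eqP->] //; exact: ltnW.
  by move=> j; rewrite !inE => /andP[_ /tm].
- rewrite extend_tau0 // linear0 add0r.
  have := omaxP t; case: omax => [M [tM MM]|te]; last by rewrite te eqxx in t0.
  have MU : M \in s :|: t by rewrite inE tM orbT.
  have UM j : j \in s :|: t -> (j <= M)%N.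
    rewrite inE => /orP[js|/MM//]; apply: ltnW; exact: (lt_st _ _ js tM).1.
  have Ms : M \notin s by apply/negP => sM; have [] := lt_st _ _ sM tM; rewrite ltnn.
  rewrite (bigD1 M) //= nabove_max // expr0 scale1r extend_tauE; first last.
  + by move=> j; rewrite !inE -val_eqE /= ltn_neqAle => /andP[-> /MM].
  + by move=> j /noM[i /MM iM ji]; exact: leq_trans iM.
  rewrite setD1K // (setD1_notin s) //.
  rewrite big1 ?addr0 // => i /andP[iU iM]; rewrite extend_tau0 ?scaler0 // => j.
  rewrite msupportD msupportU => ja; exists M; first by rewrite !inE eq_sym iM.
  by case/orP: ja => [/noM[k /MM kM jk]|/eqP->]; [exact: leq_trans kM | exact: UM].
Qed.

(** The same argument with the smallest vertex [r] that can be put below [s].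
    The right-hand side is the term which [extend_tau_homotopy] leaves over
    when [t] is emptied. *)
Lemma extend_sigma_homotopy (al : 'X_{1..n}) (s : {set 'I_n}) (M : 'I_n) : s != set0 ->
  (forall i, i \in s -> (i < M)%N /\ E i M) ->
  (forall i, i \in msupport al -> (i <= M)%N) -> M \in msupport al ->
  d (extend_sigma al s) + \sum_(i in s) (-1) ^+ (nabove i s).+1 *:
      extend_sigma (al + U_(i)) (s :\ i) = extend_tau al s set0.
Proof.
move=> s0 sM aM Ma; have [ga eal] := mnm_split Ma.
have gM i : i \in msupport ga -> (i <= M)%N by move=> ig; rewrite aM // eal msupportD ig.
rewrite {3}eal extend_tauE ?setU0 //; last by move=> j; rewrite inE.
have stM : is_symbol E (s, [set M]).
  apply/(symbolP E_up); split=> // [|i j si /set1P->]; last exact: sM.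
  by apply/set0Pn; exists M; rewrite inE.
pose bad := extend_sigma_set M al s; have := ominP bad; case: omin => [r|bad0].
- rewrite {1}/bad inE => -[/andP[ra /and3P[rM ErM /forall_inP rs]] rmin].
  have rg : r \in msupport ga.
    by move: ra; rewrite eal msupportD msupportU -val_eqE /= (ltn_eqF rM) orbF.
  have [be ega] := mnm_split rg.
  have bM i : i \in msupport be -> (i <= M)%N.
    by move=> ib; apply: gM; rewrite ega msupportD ib.
  have rmin' j : j \in msupport al -> (j < M)%N -> E j M ->
      (forall i, i \in s -> (j < i)%N) -> (r <= j)%N.
    move=> ja jM EjM js; apply: rmin; rewrite inE ja jM EjM /=.
    exact/forall_inP.
  have bal j : j \in msupport be -> j \in msupport al.
    by move=> jb; rewrite eal ega !msupportD jb.
  have rns : r \notin s by apply/negP => /rs; rewrite ltnn.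
  have rsM : is_symbol E (r |: s, [set M]).
    apply/(symbolP E_up); split=> [||i j]; try by apply/set0Pn; exists r; rewrite !inE eqxx.
      by case/(symbolP E_up): stM.
    by rewrite !inE => /orP[/eqP->|si] /eqP-> //; exact: sM.
  rewrite {1}eal ega extend_sigmaE //; last by move=> j /bal; exact: rmin'.
  rewrite linearZ /= d_sym //; last first.
    by rewrite cardsU1 rns cards1; move: s0; rewrite -card_gt0; clear; lia.
  have -> : (r |: s) :|: [set M] = r |: (M |: s) by rewrite -setUA [s :|: _]setUC.
  have Mns : M \notin s by apply/negP => /sM[]; rewrite ltnn.
  have rMs : r \notin M |: s by rewrite !inE negb_or rns andbT -val_eqE /= ltn_eqF.
  rewrite -scalerA scale_face_sum big_setU1 //= big_setU1 //=.
  rewrite setDv gsym_t0 !scaler0 add0r setU1K // (setD1_notin [set M]) ?inE; last first.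
    by rewrite -val_eqE /= ltn_eqF.
  rewrite nabove_min; last by move=> j; rewrite !inE => /orP[/eqP->|/rs].
  rewrite cardsU1 Mns add1n scalerDr scalerA -expr2 sqrr_sign scale1r.
  rewrite -addrA scaler_sumr -big_split /= big1 ?addr0 // => i si.
  have ri := rs _ si; have [iM EiM] := sM _ si.
  rewrite nabove_bot // nabove_top //; last by move=> j /sM[].
  have -> : (r |: s) :\ i = r |: (s :\ i).
    by apply/setP => j; rewrite !inE; case: (eqVneq j r) => //= ->;
      rewrite -val_eqE /= ltn_eqF.
  rewrite (setD1_notin [set M]) ?inE; last by rewrite -val_eqE /= ltn_eqF.
  have -> : (al + U_(i) = (be + U_(i)) + U_(r) + U_(M))%MM.
    by rewrite eal ega addmAC [(be + _ + _)%MM]addmAC.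
  rewrite extend_sigmaE //; first last.
  - move=> j; rewrite msupportD msupportU => /orP[/bal ja jM EjM jsi|/eqP->];
    last by move=> *; apply: ltnW.
    have [ij|ji] := leqP i j; first by rewrite (leq_trans (ltnW ri)).
    apply: rmin' => // x sx; have [->|xi] := eqVneq x i; first by [].
    by apply: jsi; rewrite !inE xi.
  - by move=> x; rewrite !inE => /andP[_ /rs].
  - by move=> x; rewrite msupportD msupportU => /orP[/bM|/eqP->] //; exact: ltnW.
  rewrite [#|s|](cardsD1 i) si !scalerA add1n -scalerDl -[RHS](scale0r (gsym (r |: s :\
    i) [set M])).
  congr (_ *: _); rewrite !exprS; ring.
(* No vertex can be added below s, so only the face without min s counts: the
   vertex that it lost can be put back. *)
- have nobad j : j \in msupport al -> (j < M)%N -> E j M ->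
      exists2 i, i \in s & (i <= j)%N.
    move=> ja jM EjM; case: (boolP [exists i in s, (i <= j)%N]) => [/exists_inP[i]|].
      by exists i.
    rewrite negb_exists_in => /forall_inP js.
    have : j \in bad by rewrite inE ja jM EjM /=; apply/forall_inP => i /js;
      rewrite -ltnNge.
    by rewrite bad0 inE.
  rewrite (extend_sigma0 Ma aM nobad) linear0 add0r.
  have := ominP s; case: omin => [m [sm mmin]|se]; last by rewrite se eqxx in s0.
  have [mM EmM] := sM _ sm.
  rewrite (bigD1 m) //= big1 ?addr0 => [|i /andP[si im]]; last first.
    rewrite (@extend_sigma0 M) ?scaler0 //.
    + by rewrite msupportD Ma.
    + move=> j; rewrite msupportD msupportU => /orP[/aM|/eqP->] //.
      by apply: ltnW; have [] := sM _ si.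
    move=> j; rewrite msupportD msupportU => ja jM EjM.
    exists m; first by rewrite !inE eq_sym im.
    case/orP: ja => [/nobad[]// x sx xj|/eqP->]; last exact: mmin.
    exact: leq_trans (mmin _ sx) xj.
  have -> : (al + U_(m) = ga + U_(m) + U_(M))%MM.
    by rewrite eal addmAC.
  have ms x : x \in s :\ m -> (m < x)%N.
    by rewrite !inE -val_eqE /= ltn_neqAle eq_sym => /andP[-> /mmin].
  rewrite extend_sigmaE //; last first.
    move=> j jg jM EjM _; have ja : j \in msupport al by rewrite eal msupportD jg.
    by have [x sx xj] := nobad _ ja jM EjM; exact: leq_trans (mmin _ sx) xj.
  rewrite setD1K // scalerA -[s in nabove m s](setD1K sm) nabove_min // mulrA.
  by rewrite -expr2 sqrr_sign mul1r.
Qed.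

Hypothesis c_sym1 : forall al s u, is_symbol E (s, [set u]) ->
  c (X al *: gsym s [set u]) = extend_tau al s [set u] + extend_sigma (al + U_(u)) s.
Hypothesis c_sym2 : forall al s t, is_symbol E (s, t) -> (1 < #|t|)%N ->
  c (X al *: gsym s t) = extend_tau al s t.
Hypothesis c_edge : forall al i j, i \in msupport al -> j \in msupport al ->
  (i < j)%N -> E i j -> c (X al *: gen None) = - extend_sigma al set0.

Lemma c_sign i x : c ((-1) ^+ i *: x) = (-1) ^+ i *: c x.
Proof.
by rewrite -signr_odd; case: odd; rewrite ?expr1 ?expr0 ?scaleN1r ?scale1r ?raddfN.
Qed.

(** [extend_tau_homotopy] and [extend_sigma_homotopy] add up.  If [t] has two
    elements [a], [b], then the faces [(s|b)] and [(s|a)], carrying [x_a] and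
    [x_b], have the same [extend_sigma] part, because it only depends on
    [x^al x_a x_b]; these parts cancel. *)
Lemma homotopy_gsym al s t : is_symbol E (s, t) ->
  d (c (X al *: gsym s t)) + c (d (X al *: gsym s t)) = X al *: gsym s t.
Proof.
move=> st; have [s0 t0 lt_st] := symbolP E_up _ _ st.
have [t1|t_neq1] := eqVneq #|t| 1%N.
- have /cards1P[u et] : #|t| == 1%N by rewrite t1.
  have us : u \notin s.
    by apply/negP => us; have [] := lt_st u u us; rewrite ?et ?inE // ltnn.
  have su i : i \in s -> (i < u)%N /\ E i u by move=> si; apply: lt_st; rewrite // et inE.
  rewrite et in st *; rewrite c_sym1 // linearD /=.
  have -> : c (d (X al *: gsym s [set u])) =
      \sum_(i in s) (-1) ^+ (nabove i s).+1 *: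
        (extend_tau (al + U_(i)) (s :\ i) [set u] + extend_sigma (al + U_(u) + U_(i))
          (s :\ i)).
    rewrite linearZ /=; have [s1|s_neq1] := eqVneq #|s| 1%N.
      have /cards1P[v es] : #|s| == 1%N by rewrite s1.
      have [vu Evu] : (v < u)%N /\ E v u by apply: su; rewrite es inE.
      rewrite es in st *; rewrite d_edge // scalerA -!XD big_set1 setDv
        extend_tau_sigma0 add0r.
      rewrite (@c_edge _ v u) //; try by rewrite !msupportD !msupportU eqxx ?orbT.
      rewrite nabove_max => [|j /set1P->] //.
      by rewrite expr1 scaleN1r addmA addmAC.
    rewrite d_sym //; last first.
      by move: s_neq1 s0; rewrite cards1 -card_gt0; clear; lia.
    rewrite scale_face_sum setUC big_setU1 //= setDv gsym_t0 !scaler0 add0r raddf_sum /=.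
    apply: eq_bigr => i si; have [iu Eiu] := su _ si.
    rewrite nabove_top //; last by move=> j /su[].
    rewrite c_sign (setD1_notin [set u]) ?inE; last by rewrite -val_eqE /= ltn_eqF.
    rewrite c_sym1 1?addmAC //; apply: (symbol_face E_up st); rewrite ?subsetDl //.
      by move: s_neq1 s0; rewrite -!card_gt0 (cardsD1 i s) si; case: #|_ :\ _|.
    by apply/set0Pn; exists u; rewrite inE.
  have := extend_tau_homotopy al st.
  rewrite setUC big_setU1 //= setDv (setD1_notin s) // nabove_max; last first.
    by move=> j; rewrite !inE => /orP[/eqP->|/su[/ltnW]].
  rewrite expr0 scale1r => <-.
  have := omaxP (msupport (al + U_(u))); case: omax => [M [Ma aM]|a0]; last first.
    by have := msupportD al U_(u) u; rewrite a0 msupportU eqxx orbT inE.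
  have uM : (u <= M)%N by apply: aM; rewrite msupportD msupportU eqxx orbT.
  rewrite -(extend_sigma_homotopy (s := s) (M := M)) // => [|i /su[iu Eiu]]; last first.
    by split; [exact: leq_trans uM | exact: E_up iu uM Eiu].
  rewrite -!addrA; congr (_ + (_ + _)).
  rewrite -big_split /=; apply: eq_bigr => i si; have [iu _] := su _ si.
  rewrite (setD1_notin [set u]) ?inE; last by rewrite -val_eqE /= ltn_eqF.
  by rewrite nabove_top // => [|j /su[]] //; rewrite scalerDr addrC.
have t_ge2 : (1 < #|t|)%N by move: t_neq1 t0; rewrite -card_gt0; clear; lia.
rewrite c_sym2 // linearZ /= d_sym //; last first.
  by move: t_ge2 s0; rewrite -card_gt0; clear; lia.
rewrite scale_face_sum raddf_sum /= -(extend_tau_homotopy al st); congr (_ + _).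
have face_extend_tau i : i \in s :|: t -> (1 < #|t :\ i|)%N ->
    c (X (al + U_(i))%MM *: gsym (s :\ i) (t :\ i)) =
      extend_tau (al + U_(i)) (s :\ i) (t :\ i).
  move=> iU ti; have [si0|si0] := eqVneq (s :\ i) set0.
    by rewrite si0 extend_tau_sigma0 gsym_s0 scaler0 raddf0.
  rewrite c_sym2 //; apply: (symbol_face E_up st); rewrite ?subsetDl //.
  by rewrite -card_gt0; apply: ltn_trans ti.
have [t2|t_neq2] := eqVneq #|t| 2%N; last first.
  apply: eq_bigr => i iU; rewrite c_sign face_extend_tau //.
  move: t_ge2 t_neq2; rewrite (cardsD1 i t); case: (i \in t);
    by rewrite ?add1n ?add0n; case: #|t :\ i| => [|[]].
have /cards2P[a [b [ab et]]] : #|t| == 2%N by rewrite t2.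
have abU : a \in s :|: t /\ b \in s :|: t by rewrite et !inE !eqxx !orbT.
have face_t i j : i \in t -> t :\ i = [set j] -> i \notin s ->
    c (X (al + U_(i))%MM *: gsym (s :\ i) (t :\ i)) =
    extend_tau (al + U_(i)) (s :\ i) (t :\ i) + extend_sigma (al + U_(i) + U_(j)) s.
  move=> ti tij si; rewrite (setD1_notin s) // tij c_sym1 //.
  apply: (symbol_face E_up st); rewrite -?tij ?subsetDl //.
  by rewrite tij; apply/set0Pn; exists j; rewrite inE.
have nts i : i \in t -> i \notin s.
  by move=> ti; apply/negP => si; have [] := lt_st _ _ si ti; rewrite ltnn.
have [ta tb] : a \in t /\ b \in t by rewrite et !inE !eqxx orbT.
have ta_b : t :\ a = [set b] by rewrite et setU1K ?inE.
have tb_a : t :\ b = [set a] by rewrite et setUC setU1K ?inE 1?eq_sym.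
have [aU bU] := abU.
rewrite (bigD1 a) //= (bigD1 b) /=; last by rewrite bU eq_sym.
rewrite [RHS](bigD1 a) //= [X in _ = _ + X](bigD1 b) /=; last by rewrite bU eq_sym.
rewrite !c_sign (face_t a b) ?nts // (face_t b a) ?nts //.
rewrite [(al + U_(b) + _)%MM]addmAC !scalerDr.
have -> : \sum_(i | [&& i \in s :|: t & i != a] && (i != b))
    c ((-1) ^+ nabove i (s :|: t) *: (X (al + U_(i))%MM *: gsym (s :\ i) (t :\ i))) =
  \sum_(i | [&& i \in s :|: t & i != a] && (i != b))
     (-1) ^+ nabove i (s :|: t) *: extend_tau (al + U_(i)) (s :\ i) (t :\ i).
  apply: eq_bigr => i /andP[/andP[iU ia] ib];
    rewrite c_sign face_extend_tau // (setD1_notin t) // et.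
  by rewrite !inE negb_or ia.
have sgn_ab : (-1) ^+ nabove a (s :|: t) = - (-1) ^+ nabove b (s :|: t) :> S.
  apply/eqP; rewrite -addr_eq0; apply/eqP; apply: sgn_pair => // j.
  rewrite inE => /orP[sj|]; last by rewrite et !inE => /orP[]/eqP->; rewrite eqxx.
  by move=> _ _; rewrite (lt_st _ _ sj ta).1 (lt_st _ _ sj tb).1.
rewrite sgn_ab !scaleNr; set A := (_ *: extend_tau (al + U_(a)) _ _);
  set W := (_ *: extend_sigma _ _).
by rewrite -!addrA; congr (_ + _); rewrite addrCA addKr.
Qed.

(** * Spans of monomials and the multigrading *)

Hypothesis c_iota : forall a x, c (iota a *: x) = iota a *: c x.
Hypothesis c_one : forall al,
  c (X al *: gen None) = 0 \/ c (X al *: gen None) = - extend_sigma al set0.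

Local Notation cellpred := ('X_{1..n} -> {set 'I_n} -> {set 'I_n} -> Prop).

(** The elements all of whose terms satisfy [P], as a linear span rather than
    through coefficients: linear maps transport such a property term by term,
    whatever cancels.  The basis element 1 of degree zero is the pair of empty
    sets. *)
Inductive inspan (P : cellpred) : F -> Prop :=
| Inspan0 : inspan P 0
| InspanD x y : inspan P x -> inspan P y -> inspan P (x + y)
| InspanM a al e : P al (sig e) (tau e) -> inspan P (iota a *: (X al *: gen e)).

Lemma inspan_imp (P Q : cellpred) x :
  (forall al (e : Defs.basis E), P al (sig e) (tau e) -> Q al (sig e) (tau e)) ->
  inspan P x -> inspan Q x.
Proof.
move=> PQ; elim=> [|y z _ hy _ hz|a al e hP]; [exact: Inspan0 | exact: InspanD |].
exact/InspanM/PQ.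
Qed.

Lemma inspanX (P : cellpred) al e : P al (sig e) (tau e) -> inspan P (X al *: gen e).
Proof. by move=> hP; rewrite -[_ *: _]scale1r -(rmorph1 iota); exact: InspanM. Qed.

Lemma inspan_gen (P : cellpred) e :
  P 0%MM (sig e) (tau e) -> inspan P (gen e).
Proof. by move=> hP; rewrite -[gen e]scale1r -X0; exact: inspanX. Qed.

Lemma inspan_scaleX (P : cellpred) be x :
  inspan (fun al s t => P (be + al)%MM s t) x -> inspan P (X be *: x).
Proof.
elim=> [|y z _ hy _ hz|a al e hP]; first by rewrite scaler0; exact: Inspan0.
  by rewrite scalerDr; exact: InspanD.
have -> : X be *: (iota a *: (X al *: gen e)) = iota a *: (X (be + al)%MM *: gen e).
  by rewrite !scalerA XD; congr (_ *: _); ring.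
exact: InspanM.
Qed.

Lemma inspan_iota P a x : inspan P x -> inspan P (iota a *: x).
Proof.
elim=> [|y z _ hy _ hz|b al e hP]; first by rewrite scaler0; exact: Inspan0.
  by rewrite scalerDr; exact: InspanD.
by rewrite scalerA -rmorphM; exact: InspanM.
Qed.

Lemma inspanN P x : inspan P x -> inspan P (- x).
Proof. by move=> hx; rewrite -scaleN1r -(rmorphN1 iota); exact: inspan_iota. Qed.

Lemma inspan_sign P i x : inspan P x -> inspan P ((-1) ^+ i *: x).
Proof. by move=> hx; rewrite -(rmorphN1 iota) -rmorphXn; exact: inspan_iota. Qed.

Lemma inspan_sum P (I : Type) (r : seq I) (p : pred I) (G : I -> F) :
  (forall i, p i -> inspan P (G i)) -> inspan P (\sum_(i <- r | p i) G i).
Proof. by move=> hG; elim/big_ind: _ => //; [exact: Inspan0 | exact: InspanD]. Qed.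

Lemma inspan_gsym P al s t :
  (is_symbol E (s, t) -> P al s t) -> inspan P (X al *: gsym s t).
Proof.
have [st hP|st _] := boolP (is_symbol E (s, t)).
  have [e [es et] ->] := gsym_genE st; apply: inspanX; rewrite es et; exact: hP.
by rewrite gsym0 // scaler0; exact: Inspan0.
Qed.

Lemma inspan_c (P Q : cellpred) x :
  (forall al (e : Defs.basis E), P al (sig e) (tau e) -> inspan Q (c (X al *: gen e))) ->
  inspan P x -> inspan Q (c x).
Proof.
move=> hPQ; elim=> [|y z _ hy _ hz|a al e hP]; first by rewrite raddf0; exact: Inspan0.
  by rewrite raddfD; exact: InspanD.
by rewrite c_iota; apply/inspan_iota/hPQ.
Qed.

Lemma linear_props (L : F -> F) : linear L ->
  [/\ L 0 = 0, forall x y, L (x + y) = L x + L y & forall a x, L (a *: x) = a *: L x].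
Proof.
move=> hL; have hD x y : L (x + y) = L x + L y by rewrite -{1}[x]scale1r hL scale1r.
have h0 : L 0 = 0 by apply: (addIr (L 0)); rewrite -hD !add0r.
by split=> // a x; rewrite -[a *: x]addr0 hL h0 addr0.
Qed.

Lemma inspan_linear (P Q : cellpred) (L : F -> F) x :
  linear L ->
  (forall al (e : Defs.basis E), P al (sig e) (tau e) ->
     inspan (fun be s t => Q (al + be)%MM s t) (L (gen e))) ->
  inspan P x -> inspan Q (L x).
Proof.
move=> /linear_props[L0 LD LZ] hPQ.
elim=> [|y z _ hy _ hz|a al e hP]; first by rewrite L0; exact: Inspan0.
  by rewrite LD; exact: InspanD.
by rewrite !LZ; apply/inspan_iota/inspan_scaleX/hPQ.
Qed.

Definition symbol_deg (s t : {set 'I_n}) : nat := (#|s| + #|t|).-1.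

Definition graded (ga : 'X_{1..n}) (m : nat) al s t : Prop :=
  (al + multideg s t)%MM = ga /\ symbol_deg s t = m.

Lemma mem_multideg i (s t : {set 'I_n}) : (i \in msupport (multideg s t)) = (i \in s :|: t).
Proof. by rewrite inE mnmE lt0b. Qed.

Lemma multideg_adjoin_max m (s t : {set 'I_n}) : m \notin s :|: t ->
  multideg s (m |: t) = (U_(m) + multideg s t)%MM.
Proof.
move=> mU; apply/mnmP => z; rewrite mnmDE !mnmE setUCA !inE [m == z]eq_sym.
by case: (eqVneq z m) => // ->; move: mU; rewrite inE => /negPf->.
Qed.

Lemma multideg_adjoin_min r (s t : {set 'I_n}) : r \notin s :|: t ->
  multideg (r |: s) t = (U_(r) + multideg s t)%MM.
Proof.
move=> mU; apply/mnmP => z; rewrite mnmDE !mnmE -setUA !inE [r == z]eq_sym.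
by case: (eqVneq z r) => // ->; move: mU; rewrite inE => /negPf->.
Qed.

Lemma multideg_face i (s t : {set 'I_n}) : i \in s :|: t ->
  (U_(i) + multideg (s :\ i) (t :\ i))%MM = multideg s t.
Proof.
move=> iU; apply/mnmP => z; rewrite mnmDE !mnmE setUD1 in_setD1 [i == z]eq_sym.
by case: (eqVneq z i) => // ->; rewrite iU.
Qed.

Lemma multideg00 : multideg set0 set0 = 0%MM :> 'X_{1..n}.
Proof. by apply/mnmP => z; rewrite !mnmE !inE. Qed.

Lemma symbol_deg_face i s t : is_symbol E (s, t) -> i \in s :|: t ->
  is_symbol E (s :\ i, t :\ i) -> (symbol_deg (s :\ i) (t :\ i)).+1 = symbol_deg s t.
Proof.
move=> st iU ist; rewrite /symbol_deg -(card_symbol E_up st) -(card_symbol E_up ist) setUD1.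
rewrite (cardsD1 i (s :|: t)) iU add1n /= prednK //.
by rewrite -setUD1 (card_symbol E_up ist); have := symbol_bdeg_gt0 E_up ist; case: addn.
Qed.

(** The last clause matters when [tau] has two elements and loses one of them:
    the coefficient of that face is a vertex above all of [sigma]. *)
Lemma d_span e : inspan (fun al s t =>
    [/\ (al + multideg s t)%MM = multideg (sig e) (tau e),
        (symbol_deg s t).+1 = symbol_deg (sig e) (tau e) &
        (1 < #|tau e|)%N -> (1 < #|t|)%N \/
          exists2 w, w \in s & forall i, i \in msupport al -> (w < i)%N])
  (d (gen e)).
Proof.
case: (genP e) => [->|[s [t [st -> -> ->]]]]; first by rewrite d_one; exact: Inspan0.
have [s0 t0 lt_st] := symbolP E_up _ _ st.
have [sz|sz] := leqP (#|s| + #|t|) 2.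
  move: s0 t0; rewrite -!card_gt0 => s0 t0.
  have /cards1P[i si] : #|s| == 1%N by move: sz s0 t0; clear; lia.
  have /cards1P[j tj] : #|t| == 1%N by move: sz s0 t0; clear; lia.
  have ij : i != j by rewrite -val_eqE /= ltn_eqF // (lt_st i j _ _).1 ?si ?tj ?inE.
  rewrite si tj in st *; rewrite d_edge // -XD; apply: inspanX => /=.
  rewrite multideg00 /symbol_deg !cards1 cards0; split=> //.
  apply/mnmP => z; rewrite !mnmDE mnm0E !mnm1E mnmE !inE ![_ == z]eq_sym.
  by case: (eqVneq z i) => [->|_]; rewrite ?(negPf ij) //; case: eqP.
rewrite d_sym //; apply: inspan_sum => i iU; rewrite /face_coef -scalerA.
apply/inspan_sign/inspan_gsym => ist; split;
  [exact: multideg_face | exact: symbol_deg_face |].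
move=> t2; have [ti|ti] := boolP (i \in t); last first.
  by left; rewrite setD1_notin.
right; have /set0Pn[w sw] := s0.
have ws : w \in s :\ i.
  rewrite !inE sw andbT; apply/eqP => wi.
  by have [] := lt_st _ _ sw ti; rewrite wi ltnn.
by exists w => // j; rewrite msupportU => /eqP->; have [] := lt_st _ _ sw ti.
Qed.

(** * Terms in the image of the homotopy *)

(** What the terms in the image of [c] look like, and what makes [c] vanish. *)
Definition c_reduced al (s t : {set 'I_n}) : Prop :=
  (forall i, i \in msupport al -> exists2 j, j \in t & (i <= j)%N) /\
  ((1 < #|t|)%N \/ forall i j, i \in msupport al -> j \in t -> E i j ->
     exists2 w, w \in s & (w <= i)%N).

(** If [t] is a single vertex, then the minimum of the multidegree [ga] lies in
    [s]. *)
Definition anchored (ga : 'X_{1..n}) (s t : {set 'I_n}) : Prop :=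
  (1 < #|t|)%N \/ exists2 w, w \in s & forall i, i \in msupport ga -> (w <= i)%N.

Lemma tau_cases e : e = None \/ (1 < #|tau e|)%N \/
  exists s u, [/\ is_symbol E (s, [set u]), sig e = s, tau e = [set u] &
                  gen e = gsym s [set u]].
Proof.
case: (genP e) => [->|[s [t [st es et eg]]]]; [by left | right].
have [_ t0 _] := symbolP E_up _ _ st.
have [t1|t_neq1] := eqVneq #|t| 1%N; last first.
  by left; rewrite et; move: t0 t_neq1; rewrite -card_gt0; case: #|t| => [|[]].
have /cards1P[u tu] : #|t| == 1%N by rewrite t1.
by right; exists s, u; rewrite -tu.
Qed.

(** The set [C_1] is empty, and so is [C_2] if [t] is a single vertex. *)
Lemma c_of_reduced al e : e <> None -> c_reduced al (sig e) (tau e) ->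
  c (X al *: gen e) = 0.
Proof.
case: (tau_cases e) => [-> //|[t2 e0 [N1 _]|[s [u [su -> -> ->]]] _ [N1 [|N2]]]].
- case: (genP e) => [//|[s [t [st es et ->]]]].
  by rewrite et in t2 N1; rewrite c_sym2 // extend_tau0.
- by rewrite cards1.
have aU i : i \in msupport al -> (i <= u)%N by case/N1 => j /set1P->.
rewrite c_sym1 // extend_tau0 ?add0r; last by move=> i /aU; exists u; rewrite ?inE.
apply: (@extend_sigma0 u); rewrite ?msupportD ?msupportU ?eqxx ?orbT //.
  by move=> i; rewrite msupportD msupportU => /orP[/aU|/eqP->].
move=> j; rewrite msupportD msupportU => /orP[ja _ Eju|/eqP->]; last by rewrite ltnn.
by apply: N2 ja _ Eju; rewrite inE.
Qed.

(** The adjoined vertex is the maximum of the coefficient, so nothing of the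
    coefficient remains above it. *)
Lemma extend_tau_span al s t : is_symbol E (s, t) ->
  inspan (fun be s' t' => [/\ graded (al + multideg s t)%MM (#|s| + #|t|) be s' t',
     c_reduced be s' t' & (1 < #|t'|)%N]) (extend_tau al s t).
Proof.
move=> st; rewrite /extend_tau; have := omaxP (msupport al).
case: omax => [m [ma mM]|_]; last exact: Inspan0.
case: forall_inP => [tm|_]; last exact: Inspan0.
have mU : m \notin s :|: t by apply/negP => /(symbol_lt_union E_up st tm); rewrite ltnn.
have mt : m \notin t by move: mU; rewrite inE negb_or => /andP[].
have t0 : (0 < #|t|)%N by have [_] := symbolP E_up _ _ st; rewrite -card_gt0.
have [be eal] := mnm_split ma; rewrite eal addmK.
apply: inspan_gsym => mst; rewrite /graded /c_reduced /symbol_deg cardsU1 mt add1n ltnS t0.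
split=> //; first by rewrite multideg_adjoin_max // addmA addnS.
split; last by left.
move=> i ib; exists m; first by rewrite !inE eqxx.
by apply: mM; rewrite eal msupportD ib.
Qed.

(** After the smallest admissible vertex [r] has been adjoined, a coefficient
    vertex that is joined to [M] cannot lie below the new [sigma]. *)
Lemma extend_sigma_span al s :
  inspan (fun be s' t' => graded (al + multideg s set0)%MM #|s|.+1 be s' t' /\
     c_reduced be s' t') (extend_sigma al s).
Proof.
rewrite /extend_sigma; have := omaxP (msupport al).
case: omax => [M [Ma aM]|_]; last exact: Inspan0.
have := ominP (extend_sigma_set M al s); case: omin => [r [ra rmin]|_]; last exact: Inspan0.
move: ra; rewrite inE => /andP[ra /and3P[rM ErM /forall_inP rs]].
have [ga eal] := mnm_split Ma; have : r \in msupport ga.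
  by move: ra; rewrite eal msupportD msupportU -val_eqE /= (ltn_eqF rM) orbF.
case/mnm_split => be ega.
have -> : (al - (U_(M) + U_(r)))%MM = be.
  by rewrite eal ega -addmA [(U_(r) + _)%MM]addmC addmK.
rewrite -scalerA.
apply/inspan_sign/inspan_gsym => st.
have rns : r \notin s by apply/negP => /rs; rewrite ltnn.
have MU : M \notin (r |: s) :|: set0.
  rewrite setU0; apply/negP => Mrs; have [_ _ /(_ M M Mrs)] := symbolP E_up _ _ st.
  by rewrite inE eqxx ltnn => /(_ isT)[].
split; first split.
- rewrite -[[set M]]setU0 multideg_adjoin_max // multideg_adjoin_min ?setU0 // !addmA.
  by rewrite eal ega [(be + U_(r) + _)%MM]addmAC.
- by rewrite /symbol_deg cardsU1 rns cards1 addn1.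
split=> [i ib|].
  by exists M; rewrite ?inE //; apply: aM; rewrite eal ega !msupportD ib.
right=> i j ib /set1P-> EiM.
have ia : i \in msupport al by rewrite eal ega !msupportD ib.
have [is_bad|] := boolP (i \in extend_sigma_set M al s).
  by exists r; [rewrite !inE eqxx | exact: rmin].
rewrite inE ia EiM /= negb_and -leqNgt => /orP[Mi|].
  by exists r; [rewrite !inE eqxx | exact: leq_trans (ltnW rM) Mi].
case/forall_inPn => w ws; rewrite -leqNgt => wi.
by exists w; rewrite // !inE ws orbT.
Qed.

Lemma c_span al e :
  inspan (fun be s t =>
    graded (al + multideg (sig e) (tau e))%MM (symbol_deg (sig e) (tau e)).+1 be s t /\
    c_reduced be s t) (c (X al *: gen e)).
Proof.
case: (tau_cases e) => [->|[t2|[s [u [su -> -> ->]]]]] /=.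
- rewrite /symbol_deg cards0 /= addn0; case: (c_one al) => ->; first exact: Inspan0.
  by apply: inspanN; have := extend_sigma_span al set0; rewrite cards0.
- case: (genP e) => [e0|[s [t [st es et ->]]]]; first by rewrite e0 cards0 in t2.
  rewrite es et in t2 *; rewrite c_sym2 // /symbol_deg prednK ?addn_gt0 ?(ltnW t2) ?orbT //.
  by apply: inspan_imp (extend_tau_span al st) => be f [].
rewrite c_sym1 // /symbol_deg cards1 addn1 /=; apply: InspanD.
  by apply: inspan_imp (extend_tau_span al su) => be f []; rewrite cards1 addn1.
have : (al + U_(u) + multideg s set0)%MM = (al + multideg s [set u])%MM.
  rewrite -[[set u]]setU0 multideg_adjoin_max ?addmA // setU0.
  apply/negP => us; have [_ _ /(_ u u us)] := symbolP E_up _ _ su.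
  by rewrite inE eqxx ltnn => /(_ isT)[].
by have := extend_sigma_span (al + U_(u)) s => /[swap] ->.
Qed.

(** No vertex of an anchored monomial can be put below [s], so [c] can only
    enlarge [t]. *)
Lemma c_span_tau_ge2 al e : e <> None ->
  anchored (al + multideg (sig e) (tau e)) (sig e) (tau e) ->
  inspan (fun be s t =>
    [/\ graded (al + multideg (sig e) (tau e))%MM (symbol_deg (sig e) (tau e)).+1 be s t,
    c_reduced be s t & (1 < #|t|)%N]) (c (X al *: gen e)).
Proof.
case: (tau_cases e) => [-> //|[t2|[s [u [su -> -> ->]]]]] e0.
- case: (genP e) => [//|[s [t [st es et ->]]]] _.
  rewrite es et in t2 *; rewrite c_sym2 // /symbol_deg prednK ?addn_gt0 ?(ltnW t2) ?orbT //.
  exact: extend_tau_span.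
case=> [|[w ws wmin]]; first by rewrite cards1.
suff sh0 : extend_sigma (al + U_(u)) s = 0.
  rewrite c_sym1 // sh0 addr0 /symbol_deg prednK ?cards1 ?addn1 //.
  by have := extend_tau_span al su; rewrite cards1 addn1.
have := omaxP (msupport (al + U_(u))); case: omax => [M [Ma aM]|a0].
  apply: (extend_sigma0 Ma aM) => j ja _ _; exists w => //; apply: wmin.
  by move: ja; rewrite !msupportD mem_multideg msupportU !in_setU in_set1 => /orP[]->;
    rewrite ?orbT.
by have := msupportD al U_(u) u; rewrite a0 msupportU eqxx orbT inE.
Qed.

(** * Unit, commutativity and the Leibniz rule *)

Hypothesis span_total : forall x, inspan (fun _ _ _ => True) x.
Variable deg : nat -> F -> Prop.
Hypothesis degP : forall m x, deg m x <-> inspan (fun _ s t => symbol_deg s t = m) x.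
Variable star : F -> F -> F.
Hypothesis star_l : forall y, linear (star^~ y).
Hypothesis star_r : forall x, linear (star x).
Hypothesis star11 : star (gen None) (gen None) = gen None.
Hypothesis star_rec : forall e e', (0 < bdeg e + bdeg e')%N ->
  star (gen e) (gen e') =
  c (star (d (gen e)) (gen e') + (-1) ^+ bdeg e *: star (gen e) (d (gen e'))).

Local Notation mdg e := (multideg (sig e) (tau e)).

Let bdegE' (e : Defs.basis E) : bdeg e = symbol_deg (sig e) (tau e).
Proof. exact: (bdegE E_up). Qed.

Lemma bdeg_gt0 (e : Defs.basis E) : (0 < bdeg e)%N = (e != None).
Proof.
case: (genP e) => [-> //|[s [t [st es et _]]]].
rewrite bdegE' es et /symbol_deg (symbol_bdeg_gt0 E_up st); case: e es et => // es et.
by case/(symbolP E_up): st; rewrite -es /= eqxx.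
Qed.

Lemma bdeg_eq0 (e : Defs.basis E) : (bdeg e == 0%N) = (e == None).
Proof. by rewrite -[LHS]negbK -lt0n bdeg_gt0 negbK. Qed.

Lemma bdeg_neqN (e : Defs.basis E) : (0 < symbol_deg (sig e) (tau e))%N -> e <> None.
Proof. by rewrite -bdegE' bdeg_gt0 => /eqP. Qed.

Lemma deg_ind m (P : F -> Prop) : P 0 -> (forall x y, P x -> P y -> P (x + y)) ->
  (forall (a : S) e, bdeg e = m -> P (a *: gen e)) -> forall x, deg m x -> P x.
Proof.
move=> P0 PD PM x /degP; elim=> [//|y z _ ? _ ?|a al e em]; first exact: PD.
rewrite scalerA; apply: PM.
by rewrite bdegE'.
Qed.

Lemma total_ind (P : F -> Prop) : P 0 -> (forall x y, P x -> P y -> P (x + y)) ->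
  (forall (a : S) e, P (a *: gen e)) -> forall x, P x.
Proof.
move=> P0 PD PM x; elim: (span_total x) => [//|y z _ ? _ ?|a al e _]; first exact: PD.
by rewrite scalerA; apply: PM.
Qed.

Lemma deg_gen e : deg (bdeg e) (gen e).
Proof. by apply/degP/inspan_gen; rewrite bdegE'. Qed.

Lemma d_deg0 x : deg 0 x -> d x = 0.
Proof.
elim/deg_ind=> [|y z hy hz|a e e0]; first exact: linear0.
  by rewrite linearD /= hy hz addr0.
have := bdeg_gt0 e; rewrite e0 => /esym/negbFE/eqP->.
by rewrite linearZ /= d_one scaler0.
Qed.

Lemma d_deg m x : deg m.+1 x -> deg m (d x).
Proof.
move=> /degP hx; apply/degP; apply: inspan_linear hx; first exact: linearP.
move=> al e em; apply: inspan_imp (d_span e) => be f [_ + _].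
by rewrite em => -[].
Qed.

Lemma dd0 x : d (d x) = 0.
Proof.
elim/total_ind: x => [|y z hy hz|a e]; first by rewrite !linear0.
  by rewrite !linearD /= hy hz addr0.
rewrite !linearZ /=; case: (genP e) => [->|[s [t [st _ _ ->]]]].
  by rewrite d_one linear0 scaler0.
by rewrite dd_gsym // scaler0.
Qed.

Lemma homotopy m x : deg m.+1 x -> d (c x) + c (d x) = x.
Proof.
move=> /degP; elim=> [|y z _ hy _ hz|a al e em].
- by rewrite !(raddf0, linear0) addr0.
- by rewrite !(raddfD, linearD) /= addrACA hy hz.
rewrite c_iota [d (iota a *: (_ *: _))]linearZ /= c_iota [d (iota a *: _)]linearZ /=
  -scalerDr.
congr (_ *: _); case: (genP e) => [e0|[s [t [st _ _ ->]]]]; last exact: homotopy_gsym.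
by rewrite e0 /= /symbol_deg !cards0 in em.
Qed.

(** How identities between products are proved: the difference of the two
    sides is a cycle that [c] kills. *)
Lemma cycle_eq0 m x : deg m.+1 x -> d x = 0 -> c x = 0 -> x = 0.
Proof. by move=> hx dx cx; rewrite -(homotopy hx) dx cx !raddf0 addr0. Qed.

Lemma msupport0 i : (i \in msupport (0%MM : 'X_{1..n})) = false.
Proof. by rewrite inE mnm0E. Qed.

Lemma c_reduced_mono1 s t : c_reduced 0%MM s t.
Proof. by split=> [i|]; [|right=> i j]; rewrite msupport0. Qed.

Lemma c_gen e : e <> None -> c (gen e) = 0.
Proof.
by move=> e0; rewrite -[gen e]scale1r -X0; apply: c_of_reduced => //;
  exact: c_reduced_mono1.
Qed.

Lemma c_d_gen e : e <> None -> c (d (gen e)) = gen e.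
Proof.
move=> e0; have := @homotopy (bdeg e).-1 (gen e).
rewrite prednK ?bdeg_gt0; last exact/eqP.
by move/(_ (deg_gen e)); rewrite c_gen // raddf0 add0r.
Qed.

Lemma starDl x y z : star (x + y) z = star x z + star y z.
Proof. by have [_ -> _] := linear_props (star_l z). Qed.
Lemma starDr x y z : star x (y + z) = star x y + star x z.
Proof. by have [_ -> _] := linear_props (star_r x). Qed.
Lemma starZl a x z : star (a *: x) z = a *: star x z.
Proof. by have [_ _ ->] := linear_props (star_l z). Qed.
Lemma starZr a x z : star x (a *: z) = a *: star x z.
Proof. by have [_ _ ->] := linear_props (star_r x). Qed.
Lemma star0l x : star 0 x = 0.
Proof. by have [-> _ _] := linear_props (star_l x). Qed.
Lemma star0r x : star x 0 = 0.
Proof. by have [-> _ _] := linear_props (star_r x). Qed.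

(** By induction [1 star e = c (1 star d e) = c (d e)], and [c (d e) = e]
    because [c e = 0]. *)
Lemma star1x x : star (gen None) x = x.
Proof.
have gens m : forall e, bdeg e = m -> star (gen None) (gen e) = gen e.
  elim/ltn_ind: m => m IH e em; have [->|/eqP e0] := eqVneq e None; first exact: star11.
  have e_gt0 : (0 < bdeg e)%N by rewrite bdeg_gt0; exact/eqP.
  rewrite star_rec ?addn_gt0 ?e_gt0 ?orbT // d_one star0l add0r expr0 scale1r.
  rewrite -[RHS](c_d_gen e0); congr (c _).
  have : deg (bdeg e).-1 (d (gen e)) by apply: d_deg; rewrite prednK //; exact: deg_gen.
  elim/deg_ind=> [|y z hy hz|a f fm]; first exact: star0r.
    by rewrite starDr hy hz.
  by rewrite starZr (IH (bdeg f)) // fm -em prednK.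
elim/total_ind: x => [|y z hy hz|a e]; first exact: star0r.
  by rewrite starDr hy hz.
by rewrite starZr (gens (bdeg e)).
Qed.

Lemma starx1 x : star x (gen None) = x.
Proof.
have gens m : forall e, bdeg e = m -> star (gen e) (gen None) = gen e.
  elim/ltn_ind: m => m IH e em; have [->|/eqP e0] := eqVneq e None; first exact: star11.
  have e_gt0 : (0 < bdeg e)%N by rewrite bdeg_gt0; exact/eqP.
  rewrite star_rec ?addn_gt0 ?e_gt0 ?orbT // d_one star0r scaler0 addr0.
  rewrite -[RHS](c_d_gen e0); congr (c _).
  have : deg (bdeg e).-1 (d (gen e)) by apply: d_deg; rewrite prednK //; exact: deg_gen.
  elim/deg_ind=> [|y z hy hz|a f fm]; first exact: star0l.
    by rewrite starDl hy hz.
  by rewrite starZl (IH (bdeg f)) // fm -em prednK.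
elim/total_ind: x => [|y z hy hz|a e]; first exact: star0l.
  by rewrite starDl hy hz.
by rewrite starZl (gens (bdeg e)).
Qed.

(** The terms of the argument of [c] in the recursion for [e star e'] come from
    products of a face of one factor with the other factor. *)
Lemma star_faces (P : cellpred) e e' :
  (forall al f, (al + mdg f)%MM = mdg e -> (bdeg f).+1 = bdeg e ->
    ((1 < #|tau e|)%N -> (1 < #|tau f|)%N \/
          exists2 w, w \in sig f & forall i, i \in msupport al -> (w < i)%N) ->
     inspan (fun be s t => P (al + be)%MM s t) (star (gen f) (gen e'))) ->
  (forall al f, (al + mdg f)%MM = mdg e' -> (bdeg f).+1 = bdeg e' ->
     inspan (fun be s t => P (al + be)%MM s t) (star (gen e) (gen f))) ->
  inspan P (star (d (gen e)) (gen e') + (-1) ^+ bdeg e *: star (gen e) (d (gen e'))).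
Proof.
move=> Pl Pr; apply: InspanD.
  apply: (inspan_linear (star_l (gen e'))) (d_span e) => al f [af bf tf].
  by apply: Pl; rewrite ?bdegE'.
apply: inspan_sign; apply: (inspan_linear (star_r (gen e))) (d_span e') => al f [af bf _].
by apply: Pr; rewrite ?bdegE'.
Qed.

Lemma star_graded e e' :
  inspan (graded (mdg e + mdg e')%MM (bdeg e + bdeg e')) (star (gen e) (gen e')).
Proof.
move em: (bdeg e + bdeg e')%N => m.
elim/ltn_ind: m e e' em => m IH e e' em.
have [m0|m0] := posnP m.
  have /eqP := em; rewrite m0 addn_eq0 !bdeg_eq0.
  case/andP=> /eqP-> /eqP->; rewrite star11; apply: inspan_gen.
  by rewrite /graded /symbol_deg /= multideg00 cards0 !addm0.
rewrite star_rec ?em //.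
apply: (@inspan_c (graded (mdg e + mdg e')%MM m.-1)) => [al f [ag am]|].
  by apply: inspan_imp (c_span al f) => be g [+ _]; rewrite ag am prednK.
apply: star_faces => al f af bf => [_|].
  apply: inspan_imp (IH (m.-1) _ f e' _); rewrite ?prednK //.
    by move=> be g [gg gm]; split; rewrite // -addmA gg addmA af.
  by apply/eq_add_S; rewrite prednK // -em -bf.
apply: inspan_imp (IH (m.-1) _ e f _); rewrite ?prednK //.
  by move=> be g [gg gm]; split; rewrite // -addmA gg addmA [(al + _)%MM]addmC -addmA af.
by apply/eq_add_S; rewrite prednK // -em -bf addnS.
Qed.

Lemma star_deg i j x y : deg i x -> deg j y -> deg (i + j) (star x y).
Proof.
move=> /degP hx /degP hy; apply/degP.
apply: (inspan_linear (star_l y)) hx => al e ei.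
apply: (inspan_linear (star_r (gen e))) hy => be f fj.
by apply: inspan_imp (star_graded e f) => ga g [_ ->]; rewrite !bdegE' ei fj.
Qed.

Lemma star_comm_ext i j :
  (forall e e', bdeg e = i -> bdeg e' = j ->
     star (gen e) (gen e') = (-1) ^+ (i * j) *: star (gen e') (gen e)) ->
  forall x y, deg i x -> deg j y -> star x y = (-1) ^+ (i * j) *: star y x.
Proof.
move=> hg x y; elim/deg_ind=> [|x1 x2 h1 h2|a e ei] hy.
- by rewrite star0l star0r scaler0.
- by rewrite starDl starDr scalerDr h1 // h2.
elim/deg_ind: hy => [|y1 y2 h1 h2|b e' ej].
- by rewrite star0l star0r scaler0.
- by rewrite starDl starDr scalerDr h1 // h2.
rewrite !(starZl, starZr) hg // !scalerA; congr (_ *: _); ring.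
Qed.

Lemma star_comm i j x y : deg i x -> deg j y -> star x y = (-1) ^+ (i * j) *: star y x.
Proof.
apply: star_comm_ext x y; move em: (i + j)%N => m.
elim/ltn_ind: m i j em => m IH i j em e e' ei ej.
have [m0|m0] := posnP m.
  have /eqP := em; rewrite m0 addn_eq0 -{1}ei -{1}ej !bdeg_eq0 => /andP[/eqP e0 /eqP e'0].
  by move: ei ej; rewrite e0 e'0 /= => <- <-; rewrite scale1r.
rewrite star_rec ?ei ?ej ?em // [star (gen e') _]star_rec ?ei ?ej 1?addnC ?em // -c_sign.
congr (c _); rewrite scalerDr addrC; congr (_ + _).
- case: j => [|j] in em ej *.
    by rewrite [d (gen e')]d_deg0 ?star0l ?star0r ?scaler0 // -ej; exact: deg_gen.
  have dj : deg j (d (gen e')) by apply: d_deg; rewrite -ej; exact: deg_gen.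
  have := @IH (i + j)%N _ i j erefl; rewrite -em addnS ltnS leqnn => /(_ isT) IHij.
  rewrite (star_comm_ext IHij _ dj) -?ei ?scalerA; last exact: deg_gen.
  by congr (_ *: _); rewrite ei -!exprD mulnS.
- case: i => [|i] in em ei *.
    by rewrite [d (gen e)]d_deg0 ?star0l ?star0r ?scaler0 // -ei; exact: deg_gen.
  have di : deg i (d (gen e)) by apply: d_deg; rewrite -ei; exact: deg_gen.
  have := @IH (i + j)%N _ i j erefl; rewrite -em addSn ltnS leqnn => /(_ isT) IHij.
  rewrite (star_comm_ext IHij di) -?ej ?scalerA; last exact: deg_gen.
  congr (_ *: _); rewrite ej -exprD mulSn addnAC addnn exprD.
  by rewrite -[in RHS](signr_odd _ j.*2) odd_double mul1r.
Qed.

Lemma leibniz_ext i j :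
  (forall e e', bdeg e = i -> bdeg e' = j -> d (star (gen e) (gen e')) =
     star (d (gen e)) (gen e') + (-1) ^+ i *: star (gen e) (d (gen e'))) ->
  forall x y, deg i x -> deg j y ->
  d (star x y) = star (d x) y + (-1) ^+ i *: star x (d y).
Proof.
move=> hg x y; elim/deg_ind=> [|x1 x2 h1 h2|a e ei] hy.
- by rewrite !(star0l, linear0, scaler0) addr0.
- by rewrite !(starDl, linearD) /= h1 // h2 // addrACA.
elim/deg_ind: hy => [|y1 y2 h1 h2|b e' ej].
- by rewrite !(star0r, linear0, scaler0) addr0.
- by rewrite !(starDr, linearD) /= h1 // h2 // addrACA.
by rewrite !(starZl, starZr, linearZ) /= hg // !scalerDr.
Qed.

(** With [y] the argument of [c] in the recursion, [d (c y) = y - c (d y)], and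
    [d y = 0] by the rule in lower degrees. *)
Lemma leibniz i j x y : deg i x -> deg j y ->
  d (star x y) = star (d x) y + (-1) ^+ i *: star x (d y).
Proof.
apply: leibniz_ext x y; move em: (i + j)%N => m.
elim/ltn_ind: m i j em => m IH i j em e e' ei ej.
have [e0|/eqP e0] := eqVneq e None.
  by move: ei; rewrite e0 d_one star0l !star1x /= => <-; rewrite add0r scale1r.
have [e'0|/eqP e'0] := eqVneq e' None.
  by rewrite e'0 d_one star0r !starx1 scaler0 addr0.
have i_gt0 : (0 < i)%N by rewrite -ei bdeg_gt0; exact/eqP.
have j_gt0 : (0 < j)%N by rewrite -ej bdeg_gt0; exact/eqP.
case: i i_gt0 => // i _ in em ei *; case: j j_gt0 => // j _ in em ej *.
have ge : deg i.+1 (gen e) by rewrite -ei; exact: deg_gen.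
have ge' : deg j.+1 (gen e') by rewrite -ej; exact: deg_gen.
have di := d_deg ge; have dj := d_deg ge'.
rewrite star_rec ?ei ?ej // -ei; set y := (X in c X); rewrite ei in y *.
have hy : deg (i + j).+1 y.
  apply/degP/InspanD; first by rewrite -addnS; apply/degP/star_deg.
  by apply: inspan_sign; rewrite -addSn; apply/degP/star_deg.
rewrite -[RHS](homotopy hy) -[LHS]addr0; congr (_ + _).
have lt1 : (i + j.+1 < m)%N by rewrite -em.
have lt2 : (i.+1 + j < m)%N by rewrite -em [in X in (_ < X)%N]addnS.
have -> : d y = 0; last by rewrite raddf0.
rewrite /y linearD linearZ /= (leibniz_ext (IH _ lt1 _ _ erefl) di ge').
rewrite (leibniz_ext (IH _ lt2 _ _ erefl) ge dj) !dd0 star0l star0r scaler0 add0r addr0.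
by rewrite exprS mulN1r scaleNr addrN.
Qed.

(** * Associativity *)

(** A multidegree vertex [i] below [s] would belong to the coefficient.  If [i]
    is in the [sigma] of one of the two factors, it is joined to a vertex of
    the corresponding [tau], hence to the top vertex [t], which contradicts
    reducedness.  If it is in a [tau], then the vertices of the corresponding
    [sigma] are lower still, and the same applies to them. *)
Lemma anchored_of_reduced al s t s1 t1 s2 t2 :
  is_symbol E (s, t) -> is_symbol E (s1, t1) -> is_symbol E (s2, t2) ->
  (al + multideg s t)%MM = (multideg s1 t1 + multideg s2 t2)%MM ->
  c_reduced al s t -> anchored (multideg s1 t1 + multideg s2 t2) s t.
Proof.
move=> st st1 st2 hga [N1 [|N2]]; first by left.
have [s0 t0 lt_st] := symbolP E_up _ _ st.
have [|t_le1] := ltnP 1 #|t|; first by left.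
right; have := ominP s; case: omin => [w [ws wmin]|se]; last by rewrite se eqxx in s0.
exists w => // i iV; rewrite leqNgt; apply/negP => iw.
have /set0Pn[u tu] := t0.
have wu : (w < u)%N by have [] := lt_st _ _ ws tu.
have ut j : j \in t -> j = u.
  move=> tj; apply/eqP; have /cards1P[v tv] : #|t| == 1%N.
    by rewrite eqn_leq t_le1 card_gt0.
  by move: tj tu; rewrite tv => /set1P-> /set1P->.
have below j : j \in msupport (multideg s1 t1 + multideg s2 t2)%MM -> (j < w)%N ->
    j \in msupport al.
  rewrite -hga msupportD mem_multideg in_setU => /orP[//|/orP[/wmin wj|/ut->]] jw.
    by rewrite ltnNge wj in jw.
  by rewrite ltnNge (ltnW wu) in jw.
have top j : j \in msupport (multideg s1 t1 + multideg s2 t2)%MM -> (j <= u)%N.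
  rewrite -hga msupportD mem_multideg in_setU => /orP[/N1[v /ut->]//|/orP[js|/ut->//]].
  by have [/ltnW] := lt_st _ _ js tu.
have no_sigma s' t' : is_symbol E (s', t') ->
    (forall j, j \in s' :|: t' -> j \in msupport (multideg s1 t1 + multideg s2 t2)%MM) ->
    forall j, j \in s' -> (j < w)%N -> False.
  move=> st' sub j js jw;
    have [_ /set0Pn[v tv] /(_ _ _ js tv)[jv Ejv]] := symbolP E_up _ _ st'.
  have vu : (v <= u)%N by apply/top/sub; rewrite inE tv orbT.
  have ja : j \in msupport al by apply: below jw; apply: sub; rewrite inE js.
  have [x xs xj] := N2 _ _ ja tu (E_up jv vu Ejv).
  by have := leq_ltn_trans (leq_trans (wmin _ xs) xj) jw; rewrite ltnn.
have no_vertex s' t' : is_symbol E (s', t') ->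
    (forall j, j \in s' :|: t' -> j \in msupport (multideg s1 t1 + multideg s2 t2)%MM) ->
    i \in s' :|: t' -> False.
  move=> st' sub; rewrite inE => /orP[is'|it']; first exact: (no_sigma _ _ st' sub i).
  have [/set0Pn[v vs] _ /(_ _ _ vs it')[vi _]] := symbolP E_up _ _ st'.
  exact: (no_sigma _ _ st' sub v vs (ltn_trans vi iw)).
move: iV; rewrite msupportD !mem_multideg => /orP[].
  by apply: (no_vertex _ _ st1) => j jU; rewrite msupportD mem_multideg jU.
by apply: (no_vertex _ _ st2) => j jU; rewrite msupportD !mem_multideg jU orbT.
Qed.

Lemma gen_symbol (e : Defs.basis E) : e <> None -> is_symbol E (sig e, tau e).
Proof. by case: (genP e) => [//|[s [t [st -> -> _]]]]. Qed.

(** All terms have positive degree, so they are symbols, and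
    [anchored_of_reduced] applies to them. *)
Lemma star_anchored (e e' : Defs.basis E) : e <> None -> e' <> None ->
  inspan (fun al s t => [/\ graded (mdg e + mdg e')%MM (bdeg e + bdeg e') al s t,
     c_reduced al s t & anchored (mdg e + mdg e') s t]) (star (gen e) (gen e')).
Proof.
move=> e0 e'0; have e_gt0 : (0 < bdeg e)%N by rewrite bdeg_gt0; exact/eqP.
have e'_gt0 : (0 < bdeg e')%N by rewrite bdeg_gt0; exact/eqP.
have m_gt0 : (0 < bdeg e + bdeg e')%N by rewrite addn_gt0 e_gt0.
suff H : inspan (fun al s t => graded (mdg e + mdg e')%MM (bdeg e + bdeg e') al s t /\
    c_reduced al s t) (star (gen e) (gen e')).
  apply: inspan_imp H => al f [[fg fm] fN].
  have f0 : f <> None by apply: bdeg_neqN; rewrite fm.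
  by split=> //; apply: anchored_of_reduced fg fN; exact: gen_symbol.
rewrite star_rec //.
apply: (@inspan_c (graded (mdg e + mdg e')%MM (bdeg e + bdeg e').-1)) => [al f [fg fm]|].
  by apply: inspan_imp (c_span al f) => be g; rewrite fg fm prednK.
apply: star_faces => al f fa fb => [_|].
  apply: inspan_imp (star_graded f e') => be g [gg gm].
  by split; [rewrite -addmA gg addmA fa | rewrite gm -fb addSn].
apply: inspan_imp (star_graded e f) => be g [gg gm].
split; first by rewrite -addmA gg addmA [(al + _)%MM]addmC -addmA fa.
by rewrite gm -fb addnS.
Qed.

(** By induction all terms of the argument of [c] are anchored, so [c] only
    enlarges their [tau].  The faces of [e] to watch are those with a single
    vertex in [tau]: their products are anchored by [star_anchored], and stay
    so with the removed vertex in the coefficient, as it lies above [sigma]. *)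
Lemma star_tau_ge2 (e e' : Defs.basis E) : (1 < #|tau e|)%N ->
  inspan (fun al s t => [/\ graded (mdg e + mdg e')%MM (bdeg e + bdeg e') al s t,
     c_reduced al s t & (1 < #|t|)%N]) (star (gen e) (gen e')).
Proof.
move em: (bdeg e + bdeg e')%N => m; elim/ltn_ind: m e e' em => m IH e e' em te.
have e0 : e <> None by move=> e0; rewrite e0 cards0 in te.
have e_gt1 : (1 < bdeg e)%N.
  have [s0 _ _] := symbolP E_up _ _ (gen_symbol e0).
  by move: s0; rewrite -card_gt0 bdegE' /symbol_deg; move: te; clear; lia.
have [e'0|/eqP e'0] := eqVneq e' None.
  rewrite e'0 in em *; rewrite starx1; apply: inspan_gen; split=> //.
    by rewrite /graded add0m /= multideg00 addm0 -bdegE' -em addn0.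
  exact: c_reduced_mono1.
have m_gt2 : (2 < m)%N.
  have : (0 < bdeg e')%N by rewrite bdeg_gt0; exact/eqP.
  by rewrite -em; move: e_gt1; clear; lia.
have m_gt0 : (0 < m)%N by apply: leq_trans m_gt2.
rewrite star_rec ?em //.
pose P al s t := graded (mdg e + mdg e')%MM m.-1 al s t /\ anchored (mdg e + mdg e') s t.
apply: (@inspan_c P) => [al f [[fg fm] fA]|].
  have f0 : f <> None by apply: bdeg_neqN; rewrite fm; move: m_gt2;
    case: m {IH em m_gt0 P fm} => [|[]].
  rewrite -fg in fA; apply: inspan_imp (c_span_tau_ge2 f0 fA) => be g.
  by rewrite fg fm prednK.
apply: star_faces => al f fa fb => [fT|].
  have [tf|[w ws wa]] := fT te.
    apply: inspan_imp (IH m.-1 _ f e' _ tf); rewrite ?prednK //; last first.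
      by apply/eq_add_S; rewrite prednK // -em -fb.
    move=> be g [[gg gm] _ gt]; split; last by left.
    by split; rewrite // -addmA gg addmA fa.
  have f0 : f <> None by apply/eqP; rewrite -bdeg_gt0; rewrite -fb in e_gt1.
  apply: inspan_imp (star_anchored f0 e'0) => be g [[gg gm] _ gA]; split.
    split; first by rewrite -addmA gg addmA fa.
    by apply/eq_add_S; rewrite gm prednK // -em -fb.
  case: gA => [|[w' w's w'min]]; [by left | right; exists w' => // i].
  have w'w : (w' <= w)%N by apply: w'min; rewrite msupportD mem_multideg in_setU ws.
  rewrite -fa -addmA msupportD => /orP[/wa wi|]; last exact: w'min.
  exact: leq_trans (ltnW wi).
apply: inspan_imp (IH m.-1 _ e f _ te); rewrite ?prednK //; last first.
  by apply/eq_add_S; rewrite prednK // -em -fb addnS.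
move=> be g [[gg gm] _ gt]; split; last by left.
by split; rewrite // -addmA gg addmA [(al + _)%MM]addmC -addmA fa.
Qed.

(** The terms of [(e1 star e2) star e3] are reduced.  Let [x^al f] be a term of
    [e1 star e2] and [x^be (s|t)] one of [f star e3].  The vertices of [al] are
    at most [max (tau f)], hence at most [max t].  If [t] is a single
    vertex, then so is [tau f]; now no vertex of [al] lies below [sig f], whose
    minimum in turn does not lie below [s]. *)
Lemma c_star_star e1 e2 e3 : e1 <> None -> e2 <> None -> e3 <> None ->
  c (star (star (gen e1) (gen e2)) (gen e3)) = 0.
Proof.
move=> e10 e20 e30.
have e1_gt0 : (0 < bdeg e1)%N by rewrite bdeg_gt0; exact/eqP.
suff H : inspan (fun al s t => (0 < symbol_deg s t)%N /\ c_reduced al s t)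
    (star (star (gen e1) (gen e2)) (gen e3)).
  elim: H => [|x y _ hx _ hy|a al e [/bdeg_neqN e0 eN]]; first exact: raddf0.
    by rewrite raddfD /= hx hy addr0.
  by rewrite c_iota c_of_reduced // scaler0.
apply: (inspan_linear (star_l (gen e3))) (star_anchored e10 e20) =>
  al f [[fg fm] [fN _] fA].
have f0 : f <> None by apply: bdeg_neqN; rewrite fm addn_gt0 e1_gt0.
have f_gt0 : (0 < bdeg f)%N by rewrite bdeg_gt0; exact/eqP.
have key be (g : Defs.basis E) :
    graded (mdg f + mdg e3)%MM (bdeg f + bdeg e3) be (sig g) (tau g) ->
    c_reduced be (sig g) (tau g) ->
    ((1 < #|tau g|)%N \/
     anchored (mdg f + mdg e3) (sig g) (tau g) /\ ~~ (1 < #|tau f|)%N) ->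
    (0 < symbol_deg (sig g) (tau g))%N /\ c_reduced (al + be) (sig g) (tau g).
  move=> [gg gm] [gN1 gN2] gA; have g_gt0 : (0 < symbol_deg (sig g) (tau g))%N.
    by rewrite gm addn_gt0 f_gt0.
  split=> //; have g0 := bdeg_neqN g_gt0.
  have [_ /set0Pn[u ug] lt_g] := symbolP E_up _ _ (gen_symbol g0).
  split.
    move=> i; rewrite msupportD => /orP[/fN[j jf ij]|]; last exact: gN1.
    have : j \in msupport (be + mdg g)%MM.
      by rewrite gg msupportD mem_multideg in_setU jf orbT.
    rewrite msupportD mem_multideg in_setU => /orP[/gN1[v vg jv]|/orP[jg|jg]].
    - by exists v => //; exact: leq_trans ij jv.
    - by exists u => //; apply: leq_trans ij _; have [/ltnW] := lt_g _ _ jg ug.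
    - by exists j.
  case: gA => [gt|[gA tf]]; [by left | have [gt|gt] := boolP (1 < #|tau g|)%N;
    first by left].
  case: gN2 => [|gN2]; first by rewrite (negPf gt).
  right=> i j; rewrite msupportD => /orP[ia _ _|]; last exact: gN2.
  case: fA => [|[w wf wmin]]; first by rewrite (negPf tf).
  case: gA => [|[w' w'g w'min]]; first by rewrite (negPf gt).
  exists w' => //; apply: leq_trans (_ : w <= i)%N.
    by apply: w'min; rewrite msupportD mem_multideg in_setU wf.
  by apply: wmin; rewrite -fg msupportD ia.
have [tf|tf] := boolP (1 < #|tau f|)%N.
  by apply: inspan_imp (star_tau_ge2 e3 tf) => be g [gg gN gt]; apply: key => //; left.
by apply: inspan_imp (star_anchored f0 e30) => be g [gg gN gA]; apply: key => //; right.
Qed.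

Lemma star_assoc_ext i j l :
  (forall e1 e2 e3, bdeg e1 = i -> bdeg e2 = j -> bdeg e3 = l ->
     star (gen e1) (star (gen e2) (gen e3)) = star (star (gen e1) (gen e2)) (gen e3)) ->
  forall x y z, deg i x -> deg j y -> deg l z -> star x (star y z) = star (star x y) z.
Proof.
move=> hg x y z hx hy hz; elim/deg_ind: hx => [|x1 x2 h1 h2|a e ei].
- by rewrite !star0l.
- by rewrite !starDl h1 h2.
rewrite !starZl; congr (_ *: _); elim/deg_ind: hy => [|x1 x2 h1 h2|b e' ej].
- by rewrite !(star0l, star0r).
- by rewrite !(starDl, starDr) h1 h2.
rewrite !(starZl, starZr); congr (_ *: _); elim/deg_ind: hz => [|x1 x2 h1 h2|b' e'' el].
- by rewrite !star0r.
- by rewrite !starDr h1 h2.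
by rewrite !starZr hg.
Qed.

(** The associator is a cycle by the Leibniz rule and induction.  Both products
    are killed by [c], the one bracketed to the right because it is, up to sign,
    bracketed to the left after commuting the factors. *)
Lemma star_assoc_deg i j l x y z : deg i x -> deg j y -> deg l z ->
  star x (star y z) = star (star x y) z.
Proof.
apply: star_assoc_ext x y z; move em: (i + j + l)%N => m.
elim/ltn_ind: m i j l em => m IH i j l em e1 e2 e3 e1i e2j e3l.
have [e10|/eqP e10] := eqVneq e1 None; first by rewrite e10 !star1x.
have [e20|/eqP e20] := eqVneq e2 None; first by rewrite e20 star1x starx1.
have [e30|/eqP e30] := eqVneq e3 None; first by rewrite e30 !starx1.
have i_gt0 : (0 < i)%N by rewrite -e1i bdeg_gt0; exact/eqP.
have j_gt0 : (0 < j)%N by rewrite -e2j bdeg_gt0; exact/eqP.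
have l_gt0 : (0 < l)%N by rewrite -e3l bdeg_gt0; exact/eqP.
have g1 : deg i (gen e1) by rewrite -e1i; exact: deg_gen.
have g2 : deg j (gen e2) by rewrite -e2j; exact: deg_gen.
have g3 : deg l (gen e3) by rewrite -e3l; exact: deg_gen.
have g12 := star_deg g1 g2; have g23 := star_deg g2 g3.
apply/eqP; rewrite -subr_eq0; apply/eqP.
have hdeg : deg (i + j + l).-1.+1 (star (gen e1) (star (gen e2) (gen e3)) -
                             star (star (gen e1) (gen e2)) (gen e3)).
  rewrite prednK ?addn_gt0 ?i_gt0 //; apply/degP/InspanD.
    by rewrite -addnA; apply/degP/star_deg.
  by apply/inspanN/degP/star_deg.
apply: (cycle_eq0 hdeg); last first.
  rewrite raddfB /= c_star_star // subr0 (star_comm g1 g23) c_sign.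
  by rewrite c_star_star // scaler0.
have [g1' g2' g3'] : [/\ deg i.-1 (d (gen e1)), deg j.-1 (d (gen e2)) &
    deg l.-1 (d (gen e3))] by split; apply: d_deg; rewrite prednK.
rewrite linearB /= (leibniz g1 g23) (leibniz g2 g3) (leibniz g12 g3) (leibniz g1 g2).
have lt1 : (i.-1 + j + l < m)%N by rewrite -em; move: i_gt0; clear; lia.
have lt2 : (i + j.-1 + l < m)%N by rewrite -em; move: j_gt0; clear; lia.
have lt3 : (i + j + l.-1 < m)%N by rewrite -em; move: l_gt0; clear; lia.
rewrite !(starDl, starDr) !(starZl, starZr).
rewrite (star_assoc_ext (IH _ lt1 _ _ _ erefl) g1' g2 g3).
rewrite (star_assoc_ext (IH _ lt2 _ _ _ erefl) g1 g2' g3).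
rewrite (star_assoc_ext (IH _ lt3 _ _ _ erefl) g1 g2 g3').
by rewrite !scalerDr !scalerA -exprD !addrA subrr.
Qed.

Lemma star_assoc x y z : star x (star y z) = star (star x y) z.
Proof.
elim/total_ind: x => [|x1 x2 h1 h2|a e]; first by rewrite !star0l.
  by rewrite !starDl h1 h2.
rewrite !starZl; congr (_ *: _); elim/total_ind: y => [|x1 x2 h1 h2|b e'].
- by rewrite !(star0l, star0r).
- by rewrite !(starDl, starDr) h1 h2.
rewrite !(starZl, starZr); congr (_ *: _); elim/total_ind: z => [|x1 x2 h1 h2|b' e''].
- by rewrite !star0r.
- by rewrite !starDr h1 h2.
rewrite !starZr; congr (_ *: _).
by apply: star_assoc_deg; exact: deg_gen.
Qed.

Theorem cdga_of_laws : is_cdga deg d star (gen None).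
Proof.
split.
- exact: linearP.
- exact: d_deg0.
- exact: d_deg.
- exact: dd0.
- exact: star_l.
- exact: star_r.
- exact: star_deg.
- exact: star_assoc.
- exact: star_comm.
- exact: (deg_gen None).
- exact: star1x.
- exact: starx1.
- exact: leibniz.
Qed.

End Calculus.

(** * The complex over the polynomial ring *)
Section BoundarySum.
Variables (S : comNzRingType) (V : lmodType S) (n : nat).

(** The exponent [|tau| + #{j in sigma, i < j}] counts the vertices of
    [sigma :|: tau] above [i], since [tau] lies above [sigma]. *)
Lemma boundary_sum (x : 'I_n -> S) (g : {set 'I_n} -> {set 'I_n} -> V) (s t : {set 'I_n}) :
  (forall i j, i \in s -> j \in t -> (i < j)%N) ->
  \sum_(i in s) ((-1) ^+ (#|t| + #|[set j in s | (i < j)%N]|) * x i) *: g (s :\ i) t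
  + \sum_(i in t) ((-1) ^+ #|[set j in t | (i < j)%N]| * x i) *: g s (t :\ i) =
  \sum_(i in s :|: t) ((-1) ^+ nabove i (s :|: t) * x i) *: g (s :\ i) (t :\ i).
Proof.
move=> lt_st; have st0 : [disjoint s & t].
  rewrite disjoint_subset; apply/subsetP => i si; rewrite inE.
  by apply/negP => ti; have := lt_st _ _ si ti; rewrite ltnn.
rewrite [RHS](eq_bigl [predU s & t]) => [|i]; last by rewrite !inE.
rewrite bigU //=; congr (_ + _); apply: eq_bigr => i iA.
  rewrite (setD1_notin t) ?(disjointFr st0) //; congr ((_ ^+ _ * _) *: _).
  rewrite /nabove -[RHS](cardsID t); congr (_ + _)%N; last first.
    apply: eq_card => j; rewrite !inE; case: (boolP (j \in t)) => jt;
      rewrite ?andbF ?orbF ?andbT //=.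
    by rewrite (disjointFl st0 jt).
  apply: eq_card => j; rewrite !inE; case: (boolP (j \in t)) => jt;
    rewrite ?andbF ?orbT //=.
  by rewrite (lt_st _ _ iA).
rewrite (setD1_notin s) ?(disjointFl st0) //; congr ((_ ^+ _ * _) *: _).
apply: eq_card => j; rewrite !inE; case: (boolP (j \in s)) => js //=.
by rewrite (disjointFr st0) //= ltnNge (ltnW (lt_st _ _ js iA)).
Qed.

End BoundarySum.

Section LinearSums.
Variables (S : comNzRingType) (V : lmodType S) (I : finType).

Lemma sum_delta (G : I -> V) i :
  \sum_j (j == i)%:R *: G j = G i.
Proof.
rewrite (bigD1 i) //= eqxx scale1r big1 ?addr0 // => j /negPf->.
by rewrite scale0r.
Qed.

Lemma sum_linear (G : I -> V) (a : S) (u v : I -> S) :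
  \sum_i (a * u i + v i) *: G i = a *: (\sum_i u i *: G i) + \sum_i v i *: G i.
Proof.
rewrite scaler_sumr -big_split /=; apply: eq_bigr => i _.
by rewrite scalerDl scalerA.
Qed.

Lemma ffun_delta_sum (x : {ffun I -> S^o}) :
  x = \sum_i (x i : S) *: ([ffun j => if j == i then 1 else 0] : {ffun I -> S^o}).
Proof.
apply/ffunP => j; rewrite sum_ffunE (bigD1 j) //= !ffunE eqxx.
rewrite big1 => [|i /negPf ij]; first by rewrite addr0 /GRing.scale /= mulr1.
by rewrite !ffunE eq_sym ij scaler0.
Qed.

End LinearSums.

Section Coordinates.
Variables (k : fieldType) (n : nat) (E : rel 'I_n).

Local Notation S := {mpoly k[n]}.
Local Notation F := (Fcx k E).
Local Notation B := (Defs.basis E).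
Local Notation bvec := (@Defs.bvec k n E).

Lemma coefD (x y : F) (e : B) : coef (x + y) e = coef x e + coef y e.
Proof. by rewrite /coef ffunE. Qed.

Lemma coefZ (a : S) (x : F) (e : B) : coef (a *: x) e = a * coef x e.
Proof. by rewrite /coef ffunE. Qed.

Lemma coef0 (e : B) : coef (0 : F) e = 0.
Proof. by rewrite /coef ffunE. Qed.

Lemma coef_bvec (e e' : B) : coef (bvec e) e' = (e' == e)%:R.
Proof. by rewrite /coef ffunE; case: eqP. Qed.

Lemma Fcx_sum (x : F) : x = \sum_e coef x e *: bvec e.
Proof. exact: ffun_delta_sum. Qed.

Lemma diff_linear : linear (@diff k n E).
Proof.
move=> a x y; rewrite /diff -sum_linear.
by apply: eq_bigr => e _; rewrite coefD coefZ.
Qed.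

Lemma diff_bvec (e : B) : diff (bvec e) = dbas k e.
Proof.
rewrite /diff -[RHS](sum_delta (dbas k (E := E)) e).
by apply: eq_bigr => f _; rewrite coef_bvec.
Qed.

Lemma coef_tensor (x y : F) (p : B * B) :
  coef2 (tensor x y) p = coef x p.1 * coef y p.2.
Proof. by rewrite /coef2 /tensor ffunE. Qed.

Lemma star_sum (x y : F) :
  star x y = \sum_p (coef x p.1 * coef y p.2) *: mubas k (bdeg2 p) p.
Proof. by rewrite /star /mu; apply: eq_bigr => p _; rewrite coef_tensor. Qed.

Lemma star_linear_l (y : F) : linear ((@star k n E)^~ y).
Proof.
move=> a x x'; rewrite !star_sum -sum_linear; apply: eq_bigr => p _.
by rewrite coefD coefZ mulrDl mulrA.
Qed.

Lemma star_linear_r (x : F) : linear (@star k n E x).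
Proof.
move=> a y y'; rewrite !star_sum -sum_linear; apply: eq_bigr => p _.
by rewrite coefD coefZ mulrDr mulrCA.
Qed.

Lemma star_bvec (e e' : B) : star (bvec e) (bvec e') = mubas k (bdeg e + bdeg e') (e, e').
Proof.
rewrite star_sum -[RHS](sum_delta (fun p => mubas k (bdeg2 p) p) (e, e')).
apply: eq_bigr => -[f f'] _; rewrite !coef_bvec xpair_eqE -mulnb natrM //.
Qed.

Lemma star_bvec11 : star (bvec None) (bvec None) = bvec None.
Proof. exact: star_bvec. Qed.

Lemma coef2D (t u : FFcx k E) p : coef2 (t + u) p = coef2 t p + coef2 u p.
Proof. by rewrite /coef2 ffunE. Qed.

Lemma coef2Z (a : S) (t : FFcx k E) p : coef2 (a *: t) p = a * coef2 t p.
Proof. by rewrite /coef2 ffunE. Qed.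

Lemma coef_dbas2 (e e' : B) q : coef2 (dbas2 k (e, e')) q =
  coef (dbas k e) q.1 * coef (bvec e') q.2 +
  (-1) ^+ bdeg e * (coef (bvec e) q.1 * coef (dbas k e') q.2).
Proof. by rewrite coef2D coef2Z !coef_tensor. Qed.

Lemma coef_bvec_neq (e f : B) : bdeg f != bdeg e -> coef (bvec e) f = 0.
Proof. by move=> fe; rewrite coef_bvec; case: (eqVneq f e) fe => // ->; rewrite eqxx. Qed.

(** [mubas m] is only meaningful in total degree [m]; the boundary of a tensor
    of total degree [m.+1] has no term of another degree. *)
Lemma star_bvec_rec (e e' : B) :
  (forall (f : B) m, bdeg f = m.+1 -> in_deg m (dbas k f)) ->
  (forall f : B, bdeg f = 0%N -> dbas k f = 0) ->
  (0 < bdeg e + bdeg e')%N -> star (bvec e) (bvec e') =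
  hpty (star (diff (bvec e)) (bvec e') +
        ((-1) ^+ bdeg e : S) *: star (bvec e) (diff (bvec e'))).
Proof.
move=> deg_dbas dbas0; rewrite star_bvec; case m_eq: (bdeg e + bdeg e')%N => [//|m] _ /=.
congr (hpty _); rewrite !diff_bvec addrC !star_sum -sum_linear.
apply: eq_bigr => q _; rewrite coef_dbas2 addrC.
have [->//|qm] := eqVneq (bdeg2 q) m.
have zero_prod (f g : B) q1 q2 : (bdeg f + bdeg g)%N = m.+1 -> (bdeg q1 + bdeg q2 != m)%N ->
    coef (dbas k f) q1 * coef (bvec g) q2 = 0.
  have [->|gq] := eqVneq (bdeg q2) (bdeg g); last by rewrite coef_bvec_neq ?mulr0.
  case fm: (bdeg f) => [|m']; first by rewrite dbas0 // coef0 mul0r.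
  by case=> <-; rewrite eqn_add2r => qm'; rewrite (deg_dbas f m') ?mul0r.
rewrite zero_prod // [X in _ * X]mulrC (zero_prod e' e) 1?addnC //.
by rewrite mulr0 addr0 !scale0r.
Qed.

Let hpart (e : B) (f : S) : F :=
  \sum_(al <- msupp f) (f@_al)%:MP *: hpty_bas k al e.

Let hpartE (e : B) f N : (msize f <= N)%N ->
  hpart e f = \sum_(m : 'X_{1..n < N}) (f@_m)%:MP *: hpty_bas k m e.
Proof.
move=> le_fN; pose I : subFinType _ := 'X_{1..n < N}.
rewrite /hpart (big_mksub I) //=; first last.
- by move=> x /msize_mdeg_lt /leq_trans; apply.
- by rewrite msupp_uniq.
rewrite big_rmcond //= => i.
by move/memN_msupp_eq0 ->; rewrite mpolyC0 scale0r.
Qed.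

Let hpartD (e : B) f g : hpart e (f + g) = hpart e f + hpart e g.
Proof.
have hN : (msize (f + g) <= maxn (msize f) (msize g))%N by exact: msizeD_le.
rewrite (hpartE _ hN) (hpartE _ (leq_maxl _ (msize g))).
rewrite (hpartE _ (leq_maxr (msize f) _)) -big_split /=.
by apply: eq_bigr => m _; rewrite mcoeffD mpolyCD scalerDl.
Qed.

Lemma hpty_zmod_morphism : zmod_morphism (@hpty k n E).
Proof.
have hD x y : hpty (x + y) = hpty x + hpty y :> F.
  rewrite /hpty -big_split; apply: eq_bigr => e _; rewrite coefD; exact: hpartD.
by move=> x y; apply/eqP; rewrite eq_sym subr_eq -hD subrK.
Qed.

Lemma hpty_monomial al (e : B) : hpty ('X_[al] *: bvec e) = hpty_bas k al e.
Proof.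
rewrite /hpty -[RHS](sum_delta (hpty_bas k al (E := E)) e); apply: eq_bigr => f _.
rewrite coefZ coef_bvec; case: eqP => _; last by rewrite mulr0 msupp0 big_nil scale0r.
by rewrite mulr1 msuppX big_seq1 mcoeffX eqxx mpolyC1.
Qed.

Lemma hpty_scaleC a (x : F) : hpty (a%:MP *: x) = a%:MP *: hpty x.
Proof.
have [->|nz_a] := eqVneq a 0;
  first by rewrite mpolyC0 !scale0r -{1}(subrr 0) hpty_zmod_morphism subrr.
rewrite /hpty scaler_sumr; apply: eq_bigr => e _.
rewrite coefZ mul_mpolyC (perm_big _ (msuppZ _ nz_a)) /= scaler_sumr.
by apply: eq_bigr => al _; rewrite mcoeffZ mpolyCM scalerA.
Qed.

Local Notation inspan := (inspan (mpolyC n (R := k)) (fun al =>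
  'X_[al] : S) (bvec : B -> F)).

Lemma Fcx_span (P : 'X_{1..n} -> {set 'I_n} -> {set 'I_n} -> Prop) (x : F) :
  (forall al (e : B), coef x e != 0 -> P al (sig e) (tau e)) -> inspan P x.
Proof.
move=> hP; rewrite (Fcx_sum x); apply: inspan_sum => e _.
have [->|nz] := eqVneq (coef x e) 0; first by rewrite scale0r; exact: Inspan0.
rewrite [coef x e in X in inspan P X]mpolyE scaler_suml; apply: inspan_sum => al _.
by rewrite -mul_mpolyC -scalerA; apply/InspanM/hP.
Qed.

Hypothesis E_up : forall i j j' : 'I_n, (i < j)%N -> (j <= j')%N -> E i j -> E i j'.

Let mon (al : 'X_{1..n}) : S := 'X_[al].

Lemma diff_sym s t : is_symbol E (s, t) -> (2 < #|s| + #|t|)%N ->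
  diff (sym k E s t) =
  \sum_(i in s :|: t) face_coef mon i (s :|: t) *: sym k E (s :\ i) (t :\ i).
Proof.
move=> st sz; have [e [es et] eg] := gsym_genE (bvec : B -> F) st.
rewrite [sym _ _ _ _]eg diff_bvec; have := bdegE E_up e; rewrite es et.
case: e es et eg => [p|]; last first.
  by move=> /= es et; move: sz; rewrite -es -et cards0.
rewrite /sig /tau => ps pt _ sz'; rewrite /dbas.
have -> : (bdeg (Some p) == 1%N) = false.
  by rewrite sz'; move: sz; case: (_ + _)%N => [|[|[]]].
rewrite ps pt; apply: boundary_sum => i j si tj.
by have [_ _ /(_ i j si tj)[]] := symbolP E_up _ _ st.
Qed.

Lemma diff_edge i j : is_symbol E ([set i], [set j]) ->
  diff (sym k E [set i] [set j]) = (mon U_(i) * mon U_(j)) *: bvec None.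
Proof.
move=> st; have [e [es et] eg] := gsym_genE (bvec : B -> F) st.
rewrite [sym _ _ _ _]eg diff_bvec; have := bdegE E_up e; rewrite es et.
case: e es et eg => [p|]; last first.
  by move=> /= es et; have := cards1 i; rewrite -es cards0.
rewrite /sig /tau => ps pt _; rewrite !cards1 => sz'; rewrite /dbas sz' /= -mpolyXD.
congr ('X_[_] *: _); rewrite /smon ps pt; apply/mnmP => z.
rewrite mnmDE !mnm1E mnmE !inE ![_ == z]eq_sym.
have ij : i != j.
  apply/eqP => ij; have [_ _ /(_ i j)] := symbolP E_up _ _ st.
  by rewrite !inE !eqxx ij ltnn => /(_ isT isT)[].
by case: (eqVneq z i) => [->|_]; rewrite ?(negPf ij) //; case: eqP.
Qed.

Lemma diff_bvec_None : diff (bvec None) = 0 :> F.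
Proof. exact: diff_bvec. Qed.

Lemma hpty_sym2 al s t : is_symbol E (s, t) -> (1 < #|t|)%N ->
  hpty (mon al *: sym k E s t) = extend_tau mon (bvec : B -> F) al s t.
Proof.
move=> st t2; have [e [es et] eg] := gsym_genE (bvec : B -> F) st.
rewrite [sym _ _ _ _]eg hpty_monomial.
case: e es et eg => [p|]; last by move=> _ /= et; rewrite -et cards0 in t2.
rewrite /sig /tau => ps pt _; rewrite /hpty_bas /hpty_symbol ps pt.
have [s0 t0 _] := symbolP E_up _ _ st.
have := ominP s; case: omin => [mins _|se]; last by rewrite se eqxx in s0.
have := ominP t; case: omin => [mint _|te]; last by rewrite te eqxx in t0.
have := omaxP t; case: omax => [maxt [tM MM]|te]; last by rewrite te eqxx in t0.
have -> : (#|t| == 1%N) = false by rewrite gtn_eqF.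
rewrite /extend_tau; have := omaxP [set i in msupport al | (maxt < i)%N].
case: omax => [m1 [+ mmax]|C0].
  rewrite inE => /andP[m1a m1t]; rewrite (omax_eq m1a) => [|j ja].
    have -> // : [forall j in t, (j < m1)%N].
    by apply/forall_inP => j /MM jM; exact: leq_ltn_trans jM m1t.
  have [jm|mj] := leqP j m1 => //.
  by have := mmax j; rewrite inE ja (ltn_trans m1t mj) leqNgt mj => /(_ isT).
have := omaxP (msupport al); case: omax => // m [ma _].
case: forall_inP => // tm; have : m \in [set i in msupport al | (maxt < i)%N].
  by rewrite inE ma tm.
by rewrite C0 inE.
Qed.

(** The sets [C_3] and [C_2] are the same set of candidates for [extend_sigma],
    in the cases where the largest vertex comes from the coefficient and where
    it is [u] itself. *)
Lemma hpty_sym1 al s u : is_symbol E (s, [set u]) ->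
  hpty (mon al *: sym k E s [set u]) =
  extend_tau mon (bvec : B -> F) al s [set u] +
  extend_sigma mon (bvec : B -> F) (al + U_(u)) s.
Proof.
move=> st; have [e [es et] eg] := gsym_genE (bvec : B -> F) st.
rewrite [sym _ _ _ _]eg hpty_monomial.
case: e es et eg => [p|]; last by move=> _ /= et; have := cards1 u; rewrite -et cards0.
rewrite /sig /tau => ps pt _; rewrite /hpty_bas /hpty_symbol ps pt.
have [s0 _ lt_st] := symbolP E_up _ _ st.
have := ominP s; case: omin => [mins [mins_s smin]|se]; last by rewrite se eqxx in s0.
rewrite (@omin_eq _ [set u] u) ?inE //; last by move=> j /set1P->.
rewrite (@omax_eq _ [set u] u) ?inE //; last by move=> j /set1P->.
rewrite cards1 eqxx.
have below_s j : [forall i in s, (j < i)%N] = (j < mins)%N.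
  apply/forall_inP/idP => [/(_ _ mins_s)//|jm i si].
  exact: leq_trans jm (smin _ si).
have mins_u : (mins < u)%N by have [] := lt_st mins u mins_s; rewrite ?inE.
have := omaxP [set i in msupport al | (u < i)%N].
case: omax => [m1 [+ mmax]|C0].
- rewrite inE => /andP[m1a um1].
  have mM j : j \in msupport al -> (j <= m1)%N.
    move=> ja; have [//|mj] := leqP j m1.
    by have := mmax j; rewrite inE ja (ltn_trans um1 mj) leqNgt mj => /(_ isT).
  rewrite /extend_tau (omax_eq m1a mM).
  have -> : [forall j in [set u], (j < m1)%N] by apply/forall_inP => j /set1P->.
  rewrite /extend_sigma (@omax_eq _ _ m1); first last.
  + by move=> j; rewrite msupportD msupportU => /orP[/mM//|/eqP->]; exact: ltnW.
  + by rewrite msupportD m1a.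
  have -> : extend_sigma_set E m1 (al + U_(u)) s =
      [set i in msupport al | (i < mins)%N && below_max_adj E (msupport al) i].
    apply/setP => j; rewrite !inE mnmDE mnm1E below_s /below_max_adj (omax_eq m1a mM).
    case: (eqVneq u j) => [<-|_]; last by rewrite addn0 [(j < mins)%N && _]andbC -andbA.
    by rewrite [(u < mins)%N]ltnNge (ltnW mins_u) /= !andbF.
  by case: omin => [m3|]; rewrite ?addr0.
(* No vertex of al lies above u, so that u is the maximum of x^al x_u. *)
rewrite extend_tau0 ?add0r; last first.
  move=> i ia; exists u; rewrite ?inE // leqNgt; apply/negP => ui.
  have : i \in [set i in msupport al | (u < i)%N] by rewrite inE ia.
  by rewrite C0 inE.
have uM_in : u \in msupport (al + U_(u)) by rewrite msupportD msupportU eqxx orbT.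
have uM j : j \in msupport (al + U_(u)) -> (j <= u)%N.
  rewrite msupportD msupportU => /orP[ja|/eqP->//]; rewrite leqNgt; apply/negP => uj.
  have : j \in [set i in msupport al | (u < i)%N] by rewrite inE ja.
  by rewrite C0 inE.
rewrite /extend_sigma (omax_eq uM_in uM).
have -> : extend_sigma_set E u (al + U_(u)) s =
    [set i in msupport al | (i < mins)%N && E i u].
  apply/setP => j; rewrite !inE mnmDE mnm1E below_s.
  case: (eqVneq u j) => [<-|uj].
    by rewrite [(u < mins)%N]ltnNge (ltnW mins_u) ltnn /= !andbF.
  rewrite addn0 [E j u && _]andbC; case: (ltnP j mins) => [jm|]; rewrite ?andbF //=.
  by rewrite (ltn_trans jm mins_u).
case: omin => [m2|]; last by [].
congr ((_ * 'X_[_]) *: _).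
by apply/mnmP => z; rewrite !mnmBE !mnmDE subnDA addnK.
Qed.

Lemma smon_le al (p : symbol E) :
  (smon p <= al)%MM = [forall i in (val p).1 :|: (val p).2, i \in msupport al].
Proof.
apply/mnm_lepP/forall_inP => [h i ip|h i].
  by have := h i; rewrite mnmE ip inE.
by rewrite mnmE; case: (boolP (i \in _)) => // /h; rewrite inE.
Qed.

Lemma edge_symbolP (p : symbol E) : bdeg (Some p) == 1%N ->
  exists i j : 'I_n, [/\ (i < j)%N, E i j, (val p).1 = [set i] & (val p).2 = [set j]].
Proof.
rewrite (bdegE E_up) /sig /tau => p1.
have pst : is_symbol E ((val p).1, (val p).2) by rewrite -surjective_pairing; exact: valP.
have [s0 t0 lt_st] := symbolP E_up _ _ pst; move: s0 t0 p1; rewrite -!card_gt0 => s0 t0 p1.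
have /cards1P[i si] : #|(val p).1| == 1%N by move: s0 t0 p1; clear; lia.
have /cards1P[j tj] : #|(val p).2| == 1%N by move: s0 t0 p1; clear; lia.
have [ij Eij] : (i < j)%N /\ E i j by apply: lt_st; rewrite ?si ?tj inE.
by exists i, j.
Qed.

Lemma edge_symbol (i j : 'I_n) : (i < j)%N -> E i j -> is_symbol E ([set i], [set j]).
Proof.
move=> ij Eij; apply/(symbolP E_up); split.
- by apply/set0Pn; exists i; rewrite inE.
- by apply/set0Pn; exists j; rewrite inE.
- by move=> x y /set1P-> /set1P->.
Qed.

Lemma prec_edge (p q : symbol E) (i j i' j' : 'I_n) :
  (val p).1 = [set i] -> (val p).2 = [set j] ->
  (val q).1 = [set i'] -> (val q).2 = [set j'] ->
  prec p q = (j' < j)%N || (j == j') && (i < i')%N.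
Proof.
move=> pi pj qi qj; rewrite /prec pi pj qi qj.
have omax1 (x : 'I_n) : omax [set x] = Some x.
  by apply: omax_eq => [|y /set1P->]; rewrite ?inE.
have omin1 (x : 'I_n) : omin [set x] = Some x.
  by apply: omin_eq => [|y /set1P->]; rewrite ?inE.
by rewrite !omax1 !omin1.
Qed.

(** The minimal edge has the largest possible upper end, and then the smallest
    lower end. *)
Lemma prec_min_extend_sigma al (p : symbol E) : prec_min_edge E al = Some p ->
  ('X_[al - smon p] : S) *: bvec (Some p) = - extend_sigma mon (bvec : B -> F) al set0.
Proof.
rewrite /prec_min_edge; case: pickP => // q /andP[/andP[q1 q_al] /forallP qmin] [<-] {p}.
have [i [j [ij Eij qi qj]]] := edge_symbolP q1.
move: (q_al); rewrite smon_le qi qj => /forall_inP in_al.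
have [ia ja] : i \in msupport al /\ j \in msupport al.
  by split; apply: in_al; rewrite !inE eqxx ?orbT.
have qmin' (i' j' : 'I_n) : i' \in msupport al -> j' \in msupport al ->
    (i' < j')%N -> E i' j' -> (j' <= j)%N /\ (j' == j -> (i <= i')%N).
  move=> ia' ja' ij' Eij'.
  pose q' : symbol E := Sub ([set i'], [set j']) (edge_symbol ij' Eij').
  have := qmin q'; rewrite (@prec_edge q' q i' j' i j) //.
  have -> : edge_divides al q'.
    rewrite /edge_divides smon_le (bdegE E_up) /sig /tau /= !cards1 /=.
    by apply/forall_inP => x; rewrite !inE => /orP[]/eqP->; rewrite -mem_msupport.
  rewrite /= negb_or -leqNgt => /andP[-> h]; split=> [//|/eqP jj].
  by move: h; rewrite jj eqxx /= -leqNgt.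
have aM x : x \in msupport al -> (x <= j)%N.
  move=> xa; rewrite leqNgt; apply/negP => jx.
  by have [] := qmin' i x ia xa (ltn_trans ij jx) (E_up ij (ltnW jx) Eij);
    rewrite leqNgt jx.
rewrite /extend_sigma (omax_eq ja aM) (@omin_eq _ _ i); first last.
- move=> x; rewrite inE => /and4P[xa xj Exj _].
  by have [_ ->] := qmin' x j xa ja xj Exj.
- by rewrite inE ia ij Eij /=; apply/forall_inP => x; rewrite inE.
rewrite cards0 expr1 mulN1r scaleNr opprK setU0.
have -> : smon q = (U_(j) + U_(i))%MM.
  apply/mnmP => z; rewrite mnmE qi qj mnmDE !mnm1E !inE ![_ == z]eq_sym.
  case: (eqVneq z i) => [->|_]; last by rewrite addn0.
  by rewrite -val_eqE /= ltn_eqF.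
by rewrite -qi -qj [X in _ = _ *: X]gsym_gen.
Qed.

(** The first case is that of a monomial outside the edge ideal. *)
Lemma hpty_one al :
  hpty (mon al *: bvec None) = 0 \/
  hpty (mon al *: bvec None) = - extend_sigma mon (bvec : B -> F) al set0.
Proof.
rewrite hpty_monomial /hpty_bas /hpty_unit; case: asboolP => _; last by left.
by case pE: (prec_min_edge E al) => [p|]; [right; exact: prec_min_extend_sigma | left].
Qed.

Lemma edge_ideal_monomial al (i j : 'I_n) : i \in msupport al -> j \in msupport al ->
  i != j -> E i j -> edge_ideal E ('X_[al] : S).
Proof.
move=> ia ja ij Eij; have [be ebe] := mnm_split ia.
have : j \in msupport be.
  by move: ja; rewrite ebe msupportD msupportU eq_sym (negPf ij) orbF.
case/mnm_split => ga ega; exists (fun x y => if (x == i) && (y == j) then 'X_[ga] else 0).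
rewrite (bigD1 i isT) (bigD1 j Eij) /= !eqxx /= big1 => [|y /andP[_ /negPf->]];
  last by rewrite mul0r.
rewrite big1 => [|x /negPf xi]; last by apply: big1 => y _; rewrite xi mul0r.
by rewrite !addr0 ebe ega -addmA [(U_(j) + _)%MM]addmC !mpolyXD.
Qed.

Lemma edge_divides_supp al (q : symbol E) (i j : 'I_n) :
  (val q).1 = [set i] -> (val q).2 = [set j] ->
  edge_divides al q = (i \in msupport al) && (j \in msupport al).
Proof.
move=> qi qj; rewrite /edge_divides smon_le (bdegE E_up) /sig /tau qi qj !cards1 /=.
apply/forall_inP/andP => [h|[ia ja] x]; first by split; apply: h; rewrite !inE eqxx ?orbT.
by rewrite in_setU !in_set1 => /orP[]/eqP->.
Qed.

(** If some edge divides [x^al], then its lower end is also joined to the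
    largest vertex of [al]. *)
Lemma prec_min_edge_exists al (i j : 'I_n) : i \in msupport al -> j \in msupport al ->
  (i < j)%N -> E i j -> exists p, prec_min_edge E al = Some p.
Proof.
move=> ia ja ij Eij; have := omaxP (msupport al).
case: omax => [M [Ma aM]|a0]; last by rewrite a0 inE in ia.
have iM : (i < M)%N := leq_trans ij (aM _ ja).
have EiM : E i M := E_up ij (aM _ ja) Eij.
have := ominP [set x in msupport al | (x < M)%N && E x M].
case: omin => [r [+ rmin]|c0]; last first.
  have : i \in [set x in msupport al | (x < M)%N && E x M] by rewrite inE ia iM.
  by rewrite c0 inE.
rewrite inE => /and3P[ra rM ErM].
pose p : symbol E := Sub ([set r], [set M]) (edge_symbol rM ErM).
rewrite /prec_min_edge; case: pickP => [q _|none]; first by exists q.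
have /negP[] := none p; rewrite (edge_divides_supp _ (i := r) (j := M)) // ra Ma /=.
apply/forallP => q; apply/implyP => qd; have /andP[q1 _] := qd.
have [i' [j' [ij' Eij' qi qj]]] := edge_symbolP q1.
move: qd; rewrite (edge_divides_supp _ qi qj) => /andP[ia' ja'].
rewrite (prec_edge (p := q) (q := p) qi qj erefl erefl) negb_or -leqNgt aM //=.
apply/negP => /andP[/eqP jM]; rewrite ltnNge rmin // inE ia' /=.
by rewrite -jM ij' Eij'.
Qed.

Lemma hpty_edge al (i j : 'I_n) : i \in msupport al -> j \in msupport al ->
  (i < j)%N -> E i j ->
  hpty (mon al *: bvec None) = - extend_sigma mon (bvec : B -> F) al set0.
Proof.
move=> ia ja ij Eij; rewrite hpty_monomial /hpty_bas /hpty_unit.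
case: asboolP => [_|[]]; last first.
  by apply: (edge_ideal_monomial ia ja) => //; rewrite -val_eqE /= ltn_eqF.
have [p pE] := prec_min_edge_exists ia ja ij Eij.
by rewrite pE; exact: prec_min_extend_sigma.
Qed.

Lemma in_degP m (x : F) : in_deg m x <-> inspan (fun _ s t => symbol_deg s t = m) x.
Proof.
split=> [hx|].
  apply: Fcx_span => _ e; apply: contraNeq => em; apply/eqP/hx.
  by rewrite (bdegE E_up).
elim=> [e _|y z _ hy _ hz e em|a al e em f fm].
- exact: coef0.
- by rewrite coefD hy // hz // addr0.
rewrite !coefZ coef_bvec_neq ?mulr0 //.
by rewrite -em in fm; rewrite [bdeg e](bdegE E_up).
Qed.

HB.instance Definition _ :=
  GRing.isLinear.Build S F F _ (@diff k n E) diff_linear.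
HB.instance Definition _ :=
  GRing.isZmodMorphism.Build F F (@hpty k n E) hpty_zmod_morphism.

Let mon0 : mon 0%MM = 1. Proof. exact: mpolyX0. Qed.
Let monD al be : mon (al + be)%MM = mon al * mon be. Proof. exact: mpolyXD. Qed.

Lemma dbas_deg0 (f : B) : bdeg f = 0%N -> dbas k f = 0.
Proof.
case: f => [p|//]; rewrite (bdegE E_up) /sig /tau => p0.
have pst : is_symbol E ((val p).1, (val p).2) by rewrite -surjective_pairing; exact: valP.
by have := symbol_bdeg_gt0 E_up pst; rewrite p0.
Qed.

Lemma dbas_deg (f : B) m : bdeg f = m.+1 -> in_deg m (dbas k f).
Proof.
move=> fm; apply/in_degP; rewrite -diff_bvec.
have := @d_span n E E_up k S F (mpolyC n (R := k)) mon monD bvec (@diff k n E)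
  diff_bvec_None diff_edge diff_sym f.
apply: inspan_imp => al e [_ + _].
by rewrite -[symbol_deg (sig f) _](bdegE E_up) fm => -[].
Qed.

Theorem cdga_of_up_closed :
  is_cdga (@in_deg k n E) (@diff k n E) (@star k n E) (bvec None).
Proof.
apply: (@cdga_of_laws n E E_up k S F (mpolyC n (R := k)) mon mon0 monD bvec
  (@diff k n E) (@hpty k n E) diff_bvec_None diff_edge diff_sym hpty_sym1 hpty_sym2
    hpty_edge).
- exact: hpty_scaleC.
- exact: hpty_one.
- by move=> x; apply: Fcx_span.
- exact: in_degP.
- exact: star_linear_l.
- exact: star_linear_r.
- exact: star_bvec11.
- by move=> e e' ee'; apply: star_bvec_rec ee' => [f m|f];
  [exact: dbas_deg | exact: dbas_deg0].
Qed.

End Coordinates.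

(** * Cointerval graphs *)

(** For [i < j] the intervals are disjoint iff [b i < a j], because the only
    way for them to meet is that [a j] lies in the first. *)
Lemma cointerval_up_closed (R : realType) (n : nat) (E : rel 'I_n) (a b : 'I_n -> R) :
  is_cointerval_repr E a b -> (forall i j : 'I_n, (i < j)%N -> a i <= a j) ->
  forall i j j' : 'I_n, (i < j)%N -> (j <= j')%N -> E i j -> E i j'.
Proof.
move=> [ab hE] a_sorted i j j' ij jj' Eij.
have ij' : (i < j')%N := leq_trans ij jj'.
have neq (x y : 'I_n) : (x < y)%N -> x != y by move=> xy; rewrite -val_eqE /= ltn_eqF.
have ajj' : a j <= a j'.
  by move: jj'; rewrite leq_eqVlt => /orP[/eqP/val_inj->//|/a_sorted].
have bi_lt : b i < a j.
  rewrite ltNge; apply/negP => aj_bi; apply: ((hE i j (neq _ _ ij)).1 Eij).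
  by exists (a j); rewrite !in_itv /= (a_sorted _ _ ij) aj_bi lexx ab.
apply/(hE i j' (neq _ _ ij')) => -[x []]; rewrite !in_itv /= => /andP[_ xb] /andP[ax _].
by have := lt_le_trans bi_lt (le_trans ajj' (le_trans ax xb)); rewrite ltxx.
Qed.

Theorem theorem2 (k : fieldType) (R : realType) (n : nat) (E : rel 'I_n)
    (a b : 'I_n -> R)
    (hE : simple_graph E)
    (hab : is_cointerval_repr E a b)
    (hsort : forall i j : 'I_n, (i < j)%N -> a i <= a j) :
  is_cdga (@in_deg k n E) (@diff k n E) (@star k n E) (@bvec k n E None).
Proof. exact/cdga_of_up_closed/(cointerval_up_closed hab hsort). Qed.
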